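(* Let $N^W$ be the Newton kernel of the flat complex symmetric space $M$ of rank $d$ and let $Y_0\in\overline{\mathfrak a^+}$. Let $\Sigma'_+=\{\alpha\in\Sigma^+:\alpha(Y_0)=0\}$, $\gamma'=|\Sigma'_+|$, $\pi'(Y)=\prod_{\alpha\in\Sigma'_+}\langle\alpha,Y\rangle$, $\rho'=\sum_{\alpha\in\Sigma'_+}\alpha$, $\pi''(Y)=\prod_{\alpha\in\Sigma^+\setminus\Sigma'_+}\langle\alpha,Y\rangle$, $\gamma=|\Sigma^+|$ and $\rho=\sum_{\alpha\in\Sigma^+}\alpha$. If $d=2$ and $\alpha,\beta$ are the simple roots, then $$N^W(X,0)=\frac{-2^{2\gamma-1}(\gamma-1)!}{2\pi\,|W|\,\pi(\rho)}\,|X|^{-2\gamma}\qquad(\text{case }Y_0=0),$$ and, if $Y_0\ne0$, $\alpha(Y_0)\neq0$ and $\beta(Y_0)=0$, $$N^W(X,Y_0)\sim\frac{-2^{2\gamma'-1}(\gamma'-1)!}{2\pi\,|W|\,\pi''(Y_0)^2\,\langle\beta,\beta\rangle}\,|X-Y_0|^{-2}\qquad\text{as }X\to Y_0 .$$ If $d\ge3$, then $$N^W(X,Y_0)\sim\frac{2^{2\gamma'}\,((d-2)/2)_{\gamma'}}{|W|\,(2-d)\,w_d\,\pi'(\rho')\,(\pi''(Y_0))^2}\,\frac{1}{|X-Y_0|^{2\gamma'+d-2}}\qquad\text{as }X\to Y_0.$$ Here $f\sim g$ as $X\to Y_0$ means $f(X)/g(X)\to1$.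
   Context: Setting. $G$ is a complex semisimple Lie group with maximal compact subgroup $K$ and Cartan decomposition $\mathfrak g=\mathfrak k\oplus\mathfrak p$; $M=\mathfrak p\simeq (K\rtimes\mathfrak p)/K$ is the flat complex symmetric space; $\mathfrak a\subset\mathfrak p$ is a maximal abelian subspace, $d=\dim\mathfrak a$; $\Sigma$ is the root system on $\mathfrak a$ with positive roots $\Sigma^+$, positive Weyl chamber $\mathfrak a^+=\{X:\alpha(X)>0\ \forall\alpha\in\Sigma^+\}$ and Weyl group $W$, $\epsilon(w)=\det w$. $\langle\cdot,\cdot\rangle$ is the Killing form on $\mathfrak a$ (used to identify $\mathfrak a$ with $\mathfrak a^*$, so $\alpha(X)=\langle\alpha,X\rangle$), $|\cdot|$ its norm, and $\mathfrak a\simeq\mathbb R^d$. $\pi(X)=\prod_{\alpha\in\Sigma^+}\alpha(X)$ (in the factor $2\pi$, $\pi$ is the number); empty products equal $1$. $w_d=2\pi^{d/2}/\Gamma(d/2)$, and $(a)_n=a(a+1)\cdots(a+n-1)$, $(a)_0=1$. The Newton kernel $N^W(X,Y)$ is the $W$-invariant kernel such that for $W$-invariant $f\in C_c$ the function $u(X)=\int_{\mathfrak a}f(Y)N^W(X,Y)\pi(Y)^2dY$ solves $\Delta^Wu=f$ with $u(X)\to0$ as $X\to\infty$, where $\Delta^W u=\pi^{-1}\Delta^{\mathbb R^d}(\pi u)$. It is given, for $X\notin W\cdot Y$, by $$N^W(X,Y)=\frac{1}{2\pi|W|\pi(X)\pi(Y)}\sum_{w\in W}\epsilon(w)\ln|X-w\cdot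 Y|\ (d=2),$$ $$N^W(X,Y)=\frac{1}{|W|(2-d)w_d\,\pi(X)\pi(Y)}\sum_{w\in W}\frac{\epsilon(w)}{|X-w\cdot Y|^{d-2}}\ (d\ge3),$$ extended by continuity to singular $X$ or $Y$ (those with $\pi(X)=0$ or $\pi(Y)=0$). *)

(* Defs.v *)
From HB Require Import structures.
From mathcomp Require Import all_boot all_order all_algebra finmap.
From mathcomp Require Import all_classical all_reals all_analysis.

Set Implicit Arguments.
Unset Strict Implicit.
Unset Printing Implicit Defensive.

Import Order.TTheory GRing.Theory Num.Theory.
Import numFieldNormedType.Exports.

Local Open Scope classical_set_scope.
Local Open Scope fset_scope.
Local Open Scope ring_scope.

(* The space a of dimension d is R^d with an orthonormal basis for the
   invariant form <.,.> chosen; roots are identified with vectors through that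
   form, so that alpha(X) = <alpha, X>.  The norm |X| is the Euclidean one; the
   library norm on 'rV[R]_d is the sup norm, which defines the same topology. *)
Definition dot (R : realType) (d : nat) (X Y : 'rV[R]_d) : R :=
  \sum_(i < d) X 0 i * Y 0 i.

Definition enorm (R : realType) (d : nat) (X : 'rV[R]_d) : R :=
  Num.sqrt (dot X X).

(* X *m refl a = X - 2 <X, a> / <a, a> a *)
Definition refl (R : realType) (d : nat) (a : 'rV[R]_d) : 'M[R]_d :=
  1%:M - (2 / dot a a) *: (a^T *m a).

(* Reduced crystallographic root systems of rank d: these are the restricted
   root systems of the complex semisimple Lie groups of rank d. *)
Record root_system (R : realType) (d : nat) (S : {fset 'rV[R]_d}) : Prop := {
  root_neq0 : forall a, a \in S -> a != 0;
  root_span : <<enum_fset S>>%VS = fullv;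
  root_reduced : forall a (c : R), a \in S -> c *: a \in S -> c = 1 \/ c = -1;
  root_refl : forall a b, a \in S -> b \in S -> b *m refl a \in S;
  root_int : forall a b, a \in S -> b \in S ->
    2 * dot b a / dot a a \is a Num.int
}.

Definition positive_system (R : realType) (d : nat) (S P : {fset 'rV[R]_d}) :=
  exists H : 'rV[R]_d, (forall a, a \in S -> dot a H != 0) /\
    P = [fset a in S | 0 < dot a H].

Definition chamber (R : realType) (d : nat) (P : {fset 'rV[R]_d}) :
    set 'rV[R]_d :=
  [set X | forall a, a \in P -> 0 < dot a X].

Definition simple_root (R : realType) (d : nat) (P : {fset 'rV[R]_d})
    (a : 'rV[R]_d) : Prop :=
  a \in P /\ ~ exists b c, [/\ b \in P, c \in P & a = b + c].

(* Elements of W act on row vectors on the right: w . Y is Y *m w. *)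
Inductive weyl (R : realType) (d : nat) (S : {fset 'rV[R]_d}) :
    'M[R]_d -> Prop :=
| weyl1 : weyl S 1%:M
| weylM a w : a \in S -> weyl S w -> weyl S (refl a *m w).

(* fset_set sends a finite set to the corresponding {fset _}, and an infinite
   one to fset0; W is finite when S is a root system. *)
Definition weylf (R : realType) (d : nat) (S : {fset 'rV[R]_d}) :
    {fset 'M[R]_d} := fset_set [set w | weyl S w].

Definition rootprod (R : realType) (d : nat) (P : {fset 'rV[R]_d})
    (X : 'rV[R]_d) : R := \prod_(a <- P) dot a X.

Definition rootsum (R : realType) (d : nat) (P : {fset 'rV[R]_d}) : 'rV[R]_d :=
  \sum_(a <- P) a.

Definition Gamma (R : realType) (x : R) : R :=
  \int[lebesgue_measure]_(t in `]0, +oo[) (t `^ (x - 1) * expR (- t)).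

(* The surface area w_d of the unit sphere of R^d *)
Definition sphere_area (R : realType) (d : nat) : R :=
  2 * pi `^ (d%:R / 2) / Gamma (d%:R / 2).

Definition pochhammer (R : realType) (a : R) (n : nat) : R :=
  \prod_(i < n) (a + i%:R).

Definition newton_formula (R : realType) (d : nat) (S P : {fset 'rV[R]_d})
    (X Y : 'rV[R]_d) : R :=
  if d == 2%N then
    (2 * pi * #|` weylf S|%:R * rootprod P X * rootprod P Y)^-1 *
    \sum_(w <- weylf S) \det w * ln (enorm (X - Y *m w))
  else
    (#|` weylf S|%:R * (2 - d%:R) * sphere_area R d *
       rootprod P X * rootprod P Y)^-1 *
    \sum_(w <- weylf S) \det w / enorm (X - Y *m w) ^+ (d - 2).

Definition regular_pairs (R : realType) (d : nat) (P : {fset 'rV[R]_d}) :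
    set ('rV[R]_d * 'rV[R]_d) :=
  [set Z | rootprod P Z.1 != 0 /\ rootprod P Z.2 != 0].

(* The Newton kernel N^W(X, Y), meaningful for X outside the orbit W . Y: the
   formula at regular pairs, extended by continuity to the other ones. *)
Definition newton (R : realType) (d : nat) (S P : {fset 'rV[R]_d})
    (X Y : 'rV[R]_d) : R :=
  if (rootprod P X != 0) && (rootprod P Y != 0) then newton_formula S P X Y
  else lim (newton_formula S P Z.1 Z.2
              @[Z --> within (regular_pairs P) (nbhs (X, Y))]).

Definition asymp_at (R : realType) (d : nat) (f g : 'rV[R]_d -> R)
    (Y0 : 'rV[R]_d) : Prop :=
  (fun X => f X / g X) @ Y0^' --> (1 : R).

(* Main.v *)
Require Import Defs.
From HB Require Import structures.
From mathcomp Require Import all_boot all_order all_algebra finmap.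
From mathcomp Require Import all_classical all_reals all_analysis.
From mathcomp Require Import measurable_realfun ring lra zify.

Set Implicit Arguments.
Unset Strict Implicit.
Unset Printing Implicit Defensive.

Import Order.TTheory GRing.Theory Num.Theory.
Import numFieldNormedType.Exports.

Local Open Scope classical_set_scope.
Local Open Scope fset_scope.
Local Open Scope ring_scope.

(** Put K(Z) = ln |Z| if d = 2 and K(Z) = |Z|^(2 - d) otherwise.  Up to a
    constant factor the Newton kernel is
      (1 / (pi(X) pi(Y))) sum_(w in W) det(w) K(X - wY),
    where pi(X) is the product of the <a, X>, a ranging over the positive roots.
    The sum over W is split along the stabiliser W' of Y0.  As Y0 is dominant,
    W' is the reflection group of the roots orthogonal to Y0 [weyl_stab], and
    P', the set of positive roots orthogonal to Y0, is its positive system; let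
    pi' and rho' be the product and the sum of P', and pi'' the product of the
    other positive roots.

    Existence of the limits.  A sum of det(w) K(X - wY) over a set of elements
    of W stable under multiplication by the reflections of P', on both sides,
    vanishes on the walls of P' in X and in Y.  Away from the poles of K it is
    therefore pi'(X) pi'(Y) g(X, Y) with g continuous [kernel_sum_div].  The
    division is carried out by iterating Hadamard's lemma in a class of
    functions stable under sums, products, inverses and square roots
    [divisible, divisible_div].  For d = 2 the logarithms are first collected
    in the quotient of two polynomials.  For the sum over W' this holds near
    (X, Y0), X != Y0; for the sum over the complement of W' it holds near
    (Y0, Y0), so that the latter contributes a bounded term.

    Leading term.  Let n = |P'| and x = X - Y0.  With Y = Y0 + t rho' and
    K(Z) = phi(|Z|^2), the sum over W' is a signed sum of the numbers
    phi(|x|^2 + t^2 |rho'|^2 - 2 t <x, w rho'>).  Weyl's denominator identity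
    [weyl_identity], in the form
      sum_(w in W') det(w) f(w rho') = sum over all choices of signs e_a = +- 1
        of (prod e_a) f(sum e_a a),   a in P',
    turns it into an iterated symmetric difference of phi, equal to
      prod_(a in P') (- 4 t <a, x>) phi^(n)(s)
    for some s tending to |x|^2 as t tends to 0, by the mean value theorem
    [sdiff_mean].  Hence g(X, Y0) = (- 4)^n phi^(n)(|x|^2) / pi'(rho')
    [stab_valueE], for singular X by continuity.  The Newton kernel is thus
    this value plus a bounded term, up to the factor 1 / (pi''(X) pi''(Y0)) and
    the constant [newton_at]; if Y0 = 0 then W' = W and there is no other
    term. *)

(** * Inner product and reflections *)

Section Dot.
Variables (R : realType) (d : nat).
Implicit Types (X Y Z a b : 'rV[R]_d) (c : R).

Lemma dotC X Y : dot X Y = dot Y X.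
Proof. by apply: eq_bigr => i _; rewrite mulrC. Qed.

Lemma dotDl X Y Z : dot (X + Y) Z = dot X Z + dot Y Z.
Proof.
by rewrite /dot -big_split; apply: eq_bigr => i _; rewrite mxE mulrDl.
Qed.

Lemma dotZl c X Y : dot (c *: X) Y = c * dot X Y.
Proof. by rewrite /dot mulr_sumr; apply: eq_bigr => i _; rewrite mxE mulrA. Qed.

Lemma dotNl X Y : dot (- X) Y = - dot X Y.
Proof. by rewrite -scaleN1r dotZl mulN1r. Qed.

Lemma dotBl X Y Z : dot (X - Y) Z = dot X Z - dot Y Z.
Proof. by rewrite dotDl dotNl. Qed.

Lemma dot0l X : dot 0 X = 0.
Proof. by rewrite -(scale0r 0) dotZl mul0r. Qed.

Lemma dotDr X Y Z : dot Z (X + Y) = dot Z X + dot Z Y.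
Proof. by rewrite dotC dotDl !(dotC Z). Qed.

Lemma dotZr c X Y : dot Y (c *: X) = c * dot Y X.
Proof. by rewrite dotC dotZl (dotC Y). Qed.

Lemma dotNr X Y : dot X (- Y) = - dot X Y.
Proof. by rewrite dotC dotNl dotC. Qed.

Lemma dotBr X Y Z : dot Z (X - Y) = dot Z X - dot Z Y.
Proof. by rewrite dotDr dotNr. Qed.

Lemma dot0r X : dot X 0 = 0.
Proof. by rewrite dotC dot0l. Qed.

Lemma dot_ge0 X : 0 <= dot X X.
Proof. by apply: sumr_ge0 => i _; rewrite -expr2 sqr_ge0. Qed.

Lemma dot_eq0 X : (dot X X == 0) = (X == 0).
Proof.
apply/eqP/eqP => [|->]; last exact: dot0l.
move=> h; apply/rowP => i; rewrite mxE; apply/eqP.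
rewrite -sqrf_eq0 expr2; apply/eqP.
apply: (psumr_eq0P (P := xpredT) _ h) => // j _.
by rewrite -expr2 sqr_ge0.
Qed.

Lemma dot_gt0 X : (0 < dot X X) = (X != 0).
Proof. by rewrite lt0r dot_eq0 dot_ge0 andbT. Qed.

Lemma dot_mx X Y : X *m Y^T = (dot X Y)%:M.
Proof.
apply/matrixP => i j; rewrite !ord1 !mxE mulr1n.
by apply: eq_bigr => k _; rewrite mxE.
Qed.

Lemma dot_trmx X Y (w : 'M[R]_d) : dot (X *m w) Y = dot X (Y *m w^T).
Proof.
suff : (dot (X *m w) Y)%:M = (dot X (Y *m w^T))%:M :> 'M[R]_1.
  by move=> /matrixP/(_ 0 0); rewrite !mxE !mulr1n.
by rewrite -!dot_mx trmx_mul trmxK mulmxA.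
Qed.

Lemma mul_refl X a : X *m refl a = X - (2 * dot X a / dot a a) *: a.
Proof.
rewrite /refl mulmxBr mulmx1 -scalemxAr mulmxA dot_mx mul_scalar_mx scalerA.
by congr (_ - _ *: _); rewrite mulrAC.
Qed.

Lemma refl_tr a : (refl a)^T = refl a.
Proof. by rewrite /refl linearB linearZ /= trmx_mul trmxK trmx1. Qed.

Lemma reflN a : refl (- a) = refl a.
Proof.
rewrite /refl dotNl dotNr opprK.
by rewrite [(- a)^T]linearN /= mulNmx mulmxN opprK.
Qed.

Lemma mul_refl_self a : a *m refl a = - a.
Proof.
rewrite mul_refl; have [->|a0] := eqVneq a 0; first by rewrite scaler0 oppr0 addr0.
by rewrite -mulrA divff ?dot_eq0// mulr1 scaler_nat mulr2n opprD addrA subrr add0r.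
Qed.

Lemma mul_refl_fix X a : dot X a = 0 -> X *m refl a = X.
Proof. by rewrite mul_refl => ->; rewrite mulr0 mul0r scale0r subr0. Qed.

Lemma mul_reflK X a : X *m refl a *m refl a = X.
Proof.
rewrite [X *m _]mul_refl mulmxBl -scalemxAl mul_refl_self mul_refl.
by rewrite scalerN opprK subrK.
Qed.

Lemma row_mx_inj (u v : 'M[R]_d) : (forall X, X *m u = X *m v) -> u = v.
Proof. by move=> h; apply/row_matrixP => i; rewrite !rowE h. Qed.

Lemma refl_sqr a : refl a *m refl a = 1%:M.
Proof. by apply: row_mx_inj => X; rewrite mulmxA mul_reflK mulmx1. Qed.

Lemma dot_refl X Y a : dot (X *m refl a) Y = dot X (Y *m refl a).
Proof. by rewrite dot_trmx refl_tr. Qed.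

Lemma det_refl a : a != 0 -> \det (refl a) = - 1.
Proof.
move=> a0; set c := 2 / dot a a.
have E : block_mx 1%:M 0 (c *: a^T) 1%:M *m block_mx 1%:M a 0 (refl a) =
    block_mx (1%:M - a *m (c *: a^T)) a 0 1%:M *m block_mx 1%:M 0 (c *: a^T) 1%:M.
  rewrite !mulmx_block !mul1mx !mul0mx !mulmx1 !mulmx0 !addr0 !add0r subrK.
  by congr block_mx; rewrite /refl -scalemxAl addrC subrK.
move/(congr1 determinant): E.
rewrite !det_mulmx !det_lblock !det_ublock !det1 !mul1r !mulr1 => ->.
rewrite -scalemxAr dot_mx -[1%:M]/(1%:M : 'M[R]_1) scale_scalar_mx -raddfB /=.
rewrite det_mx11 !mxE /= !mulr1n /c divfK ?dot_eq0 //; lra.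
Qed.

End Dot.

(** * Positive and simple roots *)

(** A finite reduced crystallographic root system [S], not required to span,
    with its positive system [P] cut out by the regular vector [H].  Dropping
    the spanning condition makes the roots orthogonal to a given vector an
    instance.  The pairing with [H] serves as a height on [P]. *)
Record based_roots (R : realType) (d : nat) (S P : {fset 'rV[R]_d})
    (H : 'rV[R]_d) : Prop := BasedRoots {
  br_neq0 : forall a, a \in S -> a != 0;
  br_reduced : forall a (c : R), a \in S -> c *: a \in S -> c = 1 \/ c = -1;
  br_refl : forall a b, a \in S -> b \in S -> b *m refl a \in S;
  br_int : forall a b, a \in S -> b \in S ->
    2 * dot b a / dot a a \is a Num.int;
  br_reg : forall a, a \in S -> dot a H != 0;
  br_pos : forall a, (a \in P) = (a \in S) && (0 < dot a H)
}.

(** An injective self-map of a finite set permutes its elements. *)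
Lemma perm_map_fset (T : choiceType) (A : {fset T}) (f : T -> T) :
  injective f -> (forall x, x \in A -> f x \in A) -> perm_eq (map f A) A.
Proof.
move=> fi fA; have uf : uniq (map f A) by rewrite map_inj_uniq.
have sub : {subset map f A <= A} by move=> x /mapP[y yA ->]; exact: fA.
have [|_ e] := uniq_min_size uf sub; first by rewrite size_map.
exact: uniq_perm.
Qed.

Section Roots.
Variables (R : realType) (d : nat) (S P : {fset 'rV[R]_d}) (H : 'rV[R]_d).
Hypothesis B : based_roots S P H.
Implicit Types (X Y Z a b : 'rV[R]_d) (c : R).

Lemma root_opp a : a \in S -> - a \in S.
Proof. by move=> aS; rewrite -mul_refl_self; apply: (br_refl B). Qed.

Lemma pos_root a : a \in P -> a \in S.
Proof. by rewrite (br_pos B) => /andP[]. Qed.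

Lemma pos_height a : a \in P -> 0 < dot a H.
Proof. by rewrite (br_pos B) => /andP[]. Qed.

Lemma pos_oppN a : a \in P -> - a \notin P.
Proof.
move=> aP; rewrite (br_pos B) dotNl negb_and -leNgt oppr_le0.
by rewrite ltW ?orbT // pos_height.
Qed.

Lemma root_pos_or a : a \in S -> a \notin P -> - a \in P.
Proof.
move=> aS; rewrite !(br_pos B) aS root_opp //= dotNl oppr_gt0 -leNgt.
by rewrite le_eqVlt (negPf (br_reg B aS)).
Qed.

Lemma pos_neq0 a : a \in P -> a != 0.
Proof. by move/pos_root/(br_neq0 B). Qed.

Lemma pos_colinear a c : a \in P -> c *: a \in P -> c *: a = a.
Proof.
move=> aP cP; case: (br_reduced B (pos_root aP) (pos_root cP)) => e.
  by rewrite e scale1r.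
by move: cP; rewrite e scaleN1r (negPf (pos_oppN aP)).
Qed.

(** The equality case of the Cauchy-Schwarz inequality. *)
Lemma dot_CS_colinear X Y : Y != 0 -> dot X Y ^+ 2 >= dot X X * dot Y Y ->
  X = (dot X Y / dot Y Y) *: Y.
Proof.
move=> Y0 h; apply/eqP; rewrite -subr_eq0 -dot_eq0 eq_le dot_ge0 andbT.
have y0 : 0 < dot Y Y by rewrite dot_gt0.
rewrite !(dotBl, dotBr, dotZl, dotZr) (dotC Y X) -(ler_pM2r y0) mul0r.
have -> : (dot X X - dot X Y / dot Y Y * dot X Y -
  dot X Y / dot Y Y * (dot X Y - dot X Y / dot Y Y * dot Y Y)) * dot Y Y =
  dot X X * dot Y Y - dot X Y ^+ 2 by field; rewrite gt_eqF.
by rewrite subr_le0.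
Qed.

Lemma root_sub a b : a \in S -> b \in S -> 0 < dot a b -> a != b -> b - a \in S.
Proof.
move=> aS bS ab ne.
have a0 := br_neq0 B aS; have b0 := br_neq0 B bS.
have na : 0 < dot a a by rewrite dot_gt0.
have nb : 0 < dot b b by rewrite dot_gt0.
have /intrP[n nE] := br_int B aS bS; have /intrP[m mE] := br_int B bS aS.
(* n m = 4 cos^2 of the angle, so that n or m is 1 *)
have nab : n * m < 4.
  rewrite -(ltr_int R) intrM -nE -mE ltNge; apply/negP => h.
  have h2 : dot a a * dot b b <= dot a b ^+ 2.
    move: h; rewrite (dotC b a) -(ler_pM2r (mulr_gt0 na nb)).
    have -> : 2 * dot a b / dot a a * (2 * dot a b / dot b b) *
      (dot a a * dot b b) = 4 * dot a b ^+ 2 by field; rewrite !gt_eqF.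
    by rewrite -[4%:~R]/(4 : R) ler_pM2l.
  have e := dot_CS_colinear b0 h2; have := aS; rewrite e => /(br_reduced B bS)[] e1.
    by move: ne; rewrite e e1 scale1r eqxx.
  by have := divr_gt0 ab nb; rewrite e1; lra.
have n0 : 0 < n by rewrite -(ltr_int R) -nE !divr_gt0 ?mulr_gt0 // dotC.
have m0 : 0 < m by rewrite -(ltr_int R) -mE !divr_gt0 ?mulr_gt0.
have : (n == 1) || (m == 1) by nia.
case/orP => /eqP e.
  by have := br_refl B aS bS; rewrite mul_refl nE e scale1r.
have := root_opp (br_refl B bS aS).
by rewrite mul_refl mE e scale1r opprB.
Qed.

Lemma ltn_height x a : x \in P -> dot x H < dot a H ->
  (#|` [fset b in P | (dot b H < dot x H)%R]| <
   #|` [fset b in P | (dot b H < dot a H)%R]|)%N.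
Proof.
move=> xP xa; apply: fproper_ltn_card; rewrite fproperE; apply/andP; split.
  by apply/fsubsetP => z; rewrite !inE /= => /andP[-> /= /lt_trans]; apply.
apply/negP => /fsubsetP/(_ x); rewrite !inE /= xP xa ltxx.
by move/(_ isT).
Qed.

(** Every positive root is a sum of simple ones. *)
Lemma pos_ind (Q : 'rV[R]_d -> Prop) :
  (forall a, simple_root P a -> Q a) ->
  (forall a b, a \in P -> b \in P -> a + b \in P -> Q a -> Q b -> Q (a + b)) ->
  forall a, a \in P -> Q a.
Proof.
move=> Qs QD a.
have [n] := ubnP #|` [fset b in P | dot b H < dot a H]|.
elim: n a => // n IH a; rewrite ltnS => le aP.
have [s|s] := pselect (simple_root P a); first exact: Qs.
have [b [c [bP cP e]]] : exists b c : 'rV[R]_d, [/\ b \in P, c \in P & a = b + c].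
  by apply: contrapT => h; apply: s; split.
have lt x y : x \in P -> y \in P -> a = x + y -> Q x.
  move=> xP yP exy; apply: IH => //; apply: leq_trans le.
  by apply: ltn_height; rewrite // exy dotDl ltrDl pos_height.
rewrite e; apply: QD => //; first by rewrite -e.
  exact: (lt b c).
by apply: (lt c b) => //; rewrite addrC.
Qed.

(** A multiple of a simple root [a] is a sum of two positive roots only if both are
    multiples of [a]: subtracting [a] from a summand that makes an acute angle with
    it decreases [n]. *)
Lemma simple_multiple a b (c : 'rV[R]_d) (n : nat) : simple_root P a ->
  b \in P -> c \in P -> b != a -> b + c = n%:R *: a -> False.
Proof.
move=> [aP sa].
have cna (b' c' : 'rV[R]_d) : c' = a -> b' \in P -> b' != a -> forall m : nat,
    b' + c' = m%:R *: a -> False.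
  move=> -> bP ba m e; have eb : b' = (m%:R - 1) *: a.
    by rewrite scalerBl scale1r -e addrK.
  by move: bP ba; rewrite eb => /(pos_colinear aP) ->; rewrite eqxx.
elim: n b c => [|[|n] IH] b c bP cP ba e.
- have := pos_height bP; have := pos_height cP.
  by have := congr1 (fun x => dot x H) e; rewrite dotDl scale0r dot0l; lra.
- by apply: sa; exists b, c; split=> //; rewrite e scale1r.
have ca : c != a by apply/eqP => ca; exact: cna ca bP ba _ e.
have step x y : x \in P -> y \in P -> x != a -> y != a ->
    x + y = n.+2%:R *: a -> 0 < dot a x -> False.
  move=> xP yP xa ya exy ax.
  have xaS : x - a \in S.
    by apply: root_sub => //; [exact: pos_root|exact: pos_root|rewrite eq_sym].
  have xaP : x - a \in P.
    apply: contrapT => /negP/(root_pos_or xaS); rewrite opprB => h.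
    by apply: sa; exists x, (a - x); split=> //; rewrite addrC subrK.
  apply: (IH _ _ xaP yP).
    apply/eqP => h; have x2 : x = 2 *: a by rewrite scaler_nat mulr2n -{1}h subrK.
    by move: xa (xP); rewrite x2 => /eqP xa /(pos_colinear aP).
  by rewrite addrAC exy -[in X in _ - X](scale1r a) -scalerBl -(addn1 n.+1) natrD addrK.
have : 0 < dot a (b + c).
  by rewrite e dotZr mulr_gt0 ?ltr0n// dot_gt0 pos_neq0.
rewrite dotDr; have [ab _|ab h] := ltP 0 (dot a b).
  exact: (step b c).
by apply: (step c b) => //; [rewrite addrC|lra].
Qed.

Lemma simple_refl_pos a b : simple_root P a -> b \in P -> b != a ->
  b *m refl a \in P.
Proof.
move=> sa bP ba; have [aP _] := sa.
have bS := br_refl B (pos_root aP) (pos_root bP).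
apply: contrapT => /negP/(root_pos_or bS) h.
have /intrP[n nE] := br_int B (pos_root aP) (pos_root bP).
move: h; rewrite mul_refl nE opprB => h.
case: n nE h => n nE h.
  by apply: (@simple_multiple a b (n%:R *: a - b) n) => //; rewrite addrC subrK.
have := pos_height h; rewrite dotBl dotZl NegzE mulrNz mulNr -pmulrn => h2.
have := pos_height bP; have := pos_height aP => aH.
by have := mulr_ge0 (ler0n R n.+1) (ltW aH); lra.
Qed.

Lemma rootsum_refl a : simple_root P a ->
  rootsum P *m refl a = rootsum P - 2 *: a.
Proof.
move=> sa; have [aP _] := sa.
have E : rootsum P = a + \sum_(b <- P `\ a) b by rewrite /rootsum (big_fsetD1 a).
rewrite E mulmxDl mul_refl_self mulmx_suml.
rewrite -(big_map (fun b => b *m refl a) xpredT id) (perm_big (P `\ a)) /=.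
  by rewrite scaler_nat mulr2n addrAC opprD addrA subrr add0r.
apply: perm_map_fset; first by move=> x y /= e; rewrite -(mul_reflK x a) e mul_reflK.
move=> b; rewrite !inE => /andP[ba bP]; rewrite simple_refl_pos // andbT.
apply/eqP => e; move: (pos_oppN aP); rewrite -mul_refl_self -[X in X *m _]e mul_reflK.
by rewrite bP.
Qed.

Lemma dot_rootsum_simple a : simple_root P a -> dot (rootsum P) a = dot a a.
Proof.
move=> sa; have := rootsum_refl sa; rewrite mul_refl => /addrI/oppr_inj.
have a0 : a != 0 by have [/pos_neq0] := sa.
move=> /(congr1 (fun x => dot x a)); rewrite !dotZl divfK ?dot_eq0 //; lra.
Qed.

Lemma dot_rootsum_pos a : a \in P -> 0 < dot (rootsum P) a.
Proof.
elim/pos_ind: a / => [a sa|a b _ _ _ ha hb].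
  by rewrite dot_rootsum_simple // dot_gt0; have [/pos_neq0] := sa.
by rewrite dotDr addr_gt0.
Qed.

(** Otherwise [a] would make an acute angle with no positive root, not even with
    itself. *)
Lemma exists_simple_acute a : a \in P ->
  exists2 b, simple_root P b & 0 < dot a b.
Proof.
move=> aP; apply: contrapT => h.
suff : forall b, b \in P -> dot a b <= 0.
  by move=> /(_ _ aP); rewrite leNgt dot_gt0 pos_neq0.
move=> b; elim/pos_ind: b / => [b sb|b c' _ _ _ ? ?].
  by rewrite leNgt; apply/negP => ab; apply: h; exists b.
by rewrite dotDr; lra.
Qed.

(** * Words in the simple reflections *)

(** The product of the reflections in the vectors of a list. *)
Definition refl_word (l : seq 'rV[R]_d) : 'M[R]_d :=
  foldr (fun a w => refl a *m w) 1%:M l.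

Lemma word_cat l1 l2 : refl_word (l1 ++ l2) = refl_word l1 *m refl_word l2.
Proof. by elim: l1 => [|a l /= ->]; rewrite /= ?mul1mx ?mulmxA. Qed.

Lemma refl_conj a b : refl (b *m refl a) = refl a *m refl b *m refl a.
Proof.
apply: row_mx_inj => X.
rewrite !mulmxA mul_refl (mul_refl (X *m refl a) b) mulmxBl mul_reflK.
rewrite -scalemxAl; congr (_ - (_ / _) *: _); first by rewrite dot_refl.
by rewrite dot_refl mul_reflK.
Qed.

(** Reflecting a non-simple positive root [a] in a simple root at an acute angle
    lowers its height, and the reflection in [a] is a conjugate of the one in the
    resulting root. *)
Lemma simple_word_refl a : a \in P ->
  exists2 l, {in l, forall b, simple_root P b} & refl a = refl_word l.
Proof.
have [n] := ubnP #|` [fset b in P | dot b H < dot a H]|.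
elim: n a => // n IH a; rewrite ltnS => le aP.
have [b sb ab] := exists_simple_acute aP; have [bP _] := sb.
have [<-|ba] := eqVneq b a.
  by exists [:: b]; rewrite /= ?mulmx1 // => x; rewrite inE => /eqP->.
have cP : a *m refl b \in P by rewrite simple_refl_pos // eq_sym.
have lt : dot (a *m refl b) H < dot a H.
  rewrite mul_refl dotBl dotZl gtrBl pmulr_rgt0 ?pos_height //.
  by rewrite divr_gt0 ?mulr_gt0 // dot_gt0 pos_neq0.
have [|l ls e] := IH _ _ cP.
  by apply: leq_trans le; exact: ltn_height.
exists (b :: l ++ [:: b]).
  by move=> x; rewrite inE mem_cat mem_seq1 => /or3P[/eqP->|/ls|/eqP->].
rewrite /= word_cat -e /= mulmx1 refl_conj !mulmxA refl_sqr mul1mx.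
by rewrite -mulmxA refl_sqr mulmx1.
Qed.

Lemma weyl_simple_word w : weyl S w ->
  exists2 l, {in l, forall b, simple_root P b} & w = refl_word l.
Proof.
elim=> [|a w' aS _ [l ls ->]]; first by exists [::].
have [l2 l2s e] : exists2 l, {in l, forall b, simple_root P b} & refl a = refl_word l.
  have [aP|aP] := boolP (a \in P); first exact: simple_word_refl.
  by rewrite -reflN; apply: simple_word_refl; exact: root_pos_or.
exists (l2 ++ l); last by rewrite word_cat e.
by move=> x; rewrite mem_cat => /orP[/l2s|/ls].
Qed.

(** The exchange condition: if a product of simple reflections makes the positive
    root [a] negative, multiplying it by the reflection in [a] deletes one
    factor. *)
Lemma exchange l a : {in l, forall b, simple_root P b} ->
  a \in P -> a *m refl_word l \notin P ->
  exists l', [/\ (size l').+1 = size l, {in l', forall b, simple_root P b}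
    & refl a *m refl_word l = refl_word l'].
Proof.
elim: l a => [|b l IH] a ls aP; first by rewrite mulmx1 aP.
have lsl : {in l, forall b, simple_root P b}.
  by move=> x xl; apply: ls; rewrite inE xl orbT.
have sb : simple_root P b by apply: ls; exact: mem_head.
rewrite /= mulmxA => h.
have [ab|ab] := eqVneq a b.
  by exists l; split=> //; rewrite ab mulmxA refl_sqr mul1mx.
have [l' [sl l's e]] := IH _ lsl (simple_refl_pos sb aP ab) h.
exists (b :: l'); split=> /=; first by rewrite sl.
  by move=> x; rewrite inE => /predU1P[->|/l's].
by rewrite -e refl_conj !mulmxA refl_sqr mul1mx.
Qed.

(** If a nonempty word preserves [P], its first factor may be removed together with
    another one, by exchange. *)
Lemma word_pos_stable l : {in l, forall b, simple_root P b} ->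
  (forall a, a \in P -> a *m refl_word l \in P) -> refl_word l = 1%:M.
Proof.
have [n] := ubnP (size l); elim: n l => // n IH [//|a l] /=.
rewrite ltnS => le ls st.
have lsl : {in l, forall b, simple_root P b}.
  by move=> x xl; apply: ls; rewrite inE xl orbT.
have [aP _] : simple_root P a by apply: ls; exact: mem_head.
have h : a *m refl_word l \notin P.
  have := st a aP; rewrite mulmxA mul_refl_self mulNmx.
  by apply: contraL => /pos_oppN.
have [l' [sl l's e]] := exchange lsl aP h.
rewrite e; apply: IH => //; first by rewrite -ltnS sl ltnW.
by move=> x xP; rewrite -e; exact: st.
Qed.

Lemma weyl_pos_stable w : weyl S w ->
  (forall a, a \in P -> a *m w \in P) -> w = 1%:M.
Proof. by move=> /weyl_simple_word[l ls ->]; exact: word_pos_stable. Qed.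

End Roots.

(** * The Weyl group *)

Lemma finite_argmax (T : choiceType) (R : realType) (A : set T) (f : T -> R) x0 :
  finite_set A -> A x0 -> exists2 x, A x & forall y, A y -> f y <= f x.
Proof.
move=> fA Ax0.
suff : forall (s : seq T) x0, x0 \in s ->
    exists2 x, x \in s & forall y, y \in s -> f y <= f x.
  move=> /(_ (fset_set A) x0)[|x]; first by rewrite in_fset_set // inE.
  rewrite in_fset_set // inE => Ax h; exists x => // y Ay.
  by apply: h; rewrite in_fset_set // inE.
elim=> // a [|b s] IH _ _; first by exists a => [|y]; rewrite inE // => /eqP->.
have [x xs h] := IH b (mem_head _ _).
have [le|lt] := leP (f a) (f x).
  by exists x; [rewrite inE xs orbT|move=> y; rewrite inE => /predU1P[->|/h]].
exists a; first exact: mem_head.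
move=> y; rewrite inE => /predU1P[->//|/h] hy; exact: le_trans hy (ltW lt).
Qed.

Section Weyl.
Variables (R : realType) (d : nat).
Implicit Types (X Y Z a b : 'rV[R]_d) (S : {fset 'rV[R]_d}) (w v : 'M[R]_d).

Lemma weyl_mulr S w v : weyl S w -> weyl S v -> weyl S (w *m v).
Proof.
by elim=> [|a w' aS _ IH] sv; rewrite ?mul1mx // -mulmxA; apply: weylM => //; exact: IH.
Qed.

Lemma weyl_refl S a : a \in S -> weyl S (refl a).
Proof. by move=> aS; rewrite -[refl a]mulmx1; apply: weylM aS _; exact: weyl1. Qed.

Lemma weyl_sub S S' w : {subset S <= S'} -> weyl S w -> weyl S' w.
Proof. by move=> h; elim=> [|a w' /h aS _ IH]; [exact: weyl1|exact: weylM]. Qed.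

Lemma weyl_orth S w : weyl S w -> w *m w^T = 1%:M.
Proof.
elim=> [|a w' aS _ IH]; first by rewrite trmx1 mulmx1.
by rewrite trmx_mul refl_tr mulmxA -(mulmxA _ w') IH mulmx1 refl_sqr.
Qed.

Lemma weyl_dot S w X Y : weyl S w -> dot (X *m w) (Y *m w) = dot X Y.
Proof. by move=> /weyl_orth h; rewrite dot_trmx -mulmxA h mulmx1. Qed.

Lemma weyl_tr S w : weyl S w -> weyl S w^T.
Proof.
elim=> [|a w' aS _ IH]; first by rewrite trmx1; exact: weyl1.
by rewrite trmx_mul refl_tr; apply: weyl_mulr => //; exact: weyl_refl.
Qed.

Lemma weyl_orthl S w : weyl S w -> w^T *m w = 1%:M.
Proof. by move=> /weyl_orth /mulmx1C. Qed.

Lemma weyl_det_sqr S w : weyl S w -> \det w * \det w = 1.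
Proof. by move=> /weyl_orth/(congr1 determinant); rewrite det_mulmx det_tr det1. Qed.

Lemma in_weylf S w : finite_set [set w | weyl S w] -> (w \in weylf S) = `[< weyl S w >].
Proof. by move=> f; rewrite in_fset_set //; apply/idP/asboolP; rewrite inE. Qed.

Lemma weylfP S w : finite_set [set w | weyl S w] -> reflect (weyl S w) (w \in weylf S).
Proof. by move=> /in_weylf ->; exact: asboolP. Qed.

Lemma weyl_root S w a :
  (forall a b, a \in S -> b \in S -> b *m refl a \in S) ->
  weyl S w -> a \in S -> a *m w \in S.
Proof.
by move=> h ww; elim: ww a => [|b w' bS _ IH] a aS; rewrite ?mulmx1 // mulmxA IH ?h.
Qed.

(** As [S] spans, an element of the group is determined by its action on [S]. *)
Lemma weyl_finite S :
  (forall a b, a \in S -> b \in S -> b *m refl a \in S) ->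
  <<enum_fset S>>%VS = fullv -> finite_set [set w | weyl S w].
Proof.
move=> h sp.
pose g (t : {ffun S -> S}) w := forall a : S, fsval a *m w = fsval (t a).
have gu t w w' : g t w -> g t w' -> w = w'.
  move=> g1 g2; apply: row_mx_inj => X.
  have XS : X \in <<in_tuple (enum_fset S)>>%VS by rewrite sp memvf.
  rewrite (coord_span XS) !mulmx_suml; apply: eq_bigr => i _.
  rewrite -!scalemxAl; congr (_ *: _).
  have iS : (enum_fset S)`_i \in S by apply: mem_nth.
  by rewrite (g1 [` iS]) (g2 [` iS]).
pose G t := xget (0 : 'M[R]_d) (g t).
apply: (@sub_finite_set _ _ (G @` setT)); last exact: finite_image.
move=> w /= ww.
pose t : {ffun S -> S} := [ffun a : S => [` weyl_root h ww (fsvalP a)]].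
have gt : g t w by move=> a; rewrite ffunE.
by exists t => //; apply: gu (gt); rewrite /G; case: xgetP => // /(_ w).
Qed.

End Weyl.

(** * Iterated symmetric differences and the Weyl denominator identity *)

Section SignFold.
Variables (V : zmodType) (T : Type) (op : T -> T -> T).
Implicit Types (l : seq V) (f : V -> T) (m : V).

(** Evaluation of [f] at the points m + sum of +- a, [a] in [l], for all choices
    of signs, combined along a binary tree by [op]. *)
Fixpoint sfold l f m : T :=
  if l is a :: l' then op (sfold l' f (m + a)) (sfold l' f (m - a)) else f m.

Lemma eq_sfold l f g m : f =1 g -> sfold l f m = sfold l g m.
Proof. by move=> fg; elim: l m => [|a l IH] m /=; rewrite ?fg ?IH. Qed.

Hypothesis op_medial : forall x y z t, op (op x y) (op z t) = op (op x z) (op y t).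

(** The medial law of [op] makes the order of [l] irrelevant. *)
Lemma sfold_rcons l1 l2 a f m :
  sfold (l1 ++ a :: l2) f m = sfold (a :: l1 ++ l2) f m.
Proof.
elim: l1 m => //= b l1 IH m; rewrite !IH /= op_medial.
by rewrite (addrAC m b a) (addrAC m b (- a)) (addrAC m (- b) a) (addrAC m (- b) (- a)).
Qed.

Lemma perm_sfold l1 l2 f m : perm_eq l1 l2 -> sfold l1 f m = sfold l2 f m.
Proof.
elim: l1 l2 m => [|a l1 IH] l2 m.
  by rewrite perm_sym => /perm_nilP ->.
move=> p; have : a \in l2 by rewrite -(perm_mem p) mem_head.
move=> al2; move: p; case/splitPr: al2 => u v.
rewrite perm_sym -cat1s perm_catCA /= perm_cons perm_sym => p.
by rewrite sfold_rcons /= !(IH _ _ p).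
Qed.

End SignFold.

Lemma sfold_map (V V' : zmodType) (T : Type) (op : T -> T -> T) (L : V -> V')
    l (f : V' -> T) m :
  {morph L : x y / x + y} -> {morph L : x y / x - y} ->
  sfold op l (f \o L) m = sfold op (map L l) f (L m).
Proof. by move=> LD LB; elim: l m => //= a l IH m; rewrite !IH LD LB. Qed.

Section SignFoldNeg.
Variables (V : zmodType) (R : realType).
Implicit Types (l : seq V) (m a : V).

(** The signed sum of the values of [f] at the points m + sum e_a a, with sign
    the product of the e_a = +- 1. *)
Definition sdiff l (f : V -> R) m := sfold (fun x y : R => x - y) l f m.

(** The predicate [Q] holds at all these points. *)
Definition sall l (Q : V -> bool) m := sfold andb l Q m.

Lemma eq_sdiff l f g m : f =1 g -> sdiff l f m = sdiff l g m.
Proof. exact: eq_sfold. Qed.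

Lemma sub_medial (x y z t : R) : x - y - (z - t) = x - z - (y - t).
Proof. by ring. Qed.

Lemma andb_medial x y z t : (x && y) && (z && t) = (x && z) && (y && t).
Proof. by case: x; case: y; case: z. Qed.

Lemma sdiff_opp l a f m : sdiff (- a :: l) f m = - sdiff (a :: l) f m.
Proof. by rewrite /sdiff /= opprK opprB. Qed.

Lemma sall_opp l a Q m : sall (- a :: l) Q m = sall (a :: l) Q m.
Proof. by rewrite /sall /= opprK andbC. Qed.

Lemma sdiffD l f g m : sdiff l (fun x => f x + g x) m = sdiff l f m + sdiff l g m.
Proof. by elim: l m => //= a l IH m; rewrite /sdiff /= -!/(sdiff _ _ _) !IH; ring. Qed.

Lemma sdiffZ l c f m : sdiff l (fun x => c * f x) m = c * sdiff l f m.
Proof. by elim: l m => //= a l IH m; rewrite /sdiff /= -!/(sdiff _ _ _) !IH; ring. Qed.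

Lemma sdiff_sum (I : Type) (r : seq I) (F : I -> V -> R) l m :
  sdiff l (fun x => \sum_(i <- r) F i x) m = \sum_(i <- r) sdiff l (F i) m.
Proof.
elim: r => [|i r IH].
  rewrite big_nil; transitivity (sdiff l (fun=> 0 * 1) m).
    by apply: eq_sdiff => x; rewrite big_nil mul0r.
  by rewrite sdiffZ mul0r.
rewrite big_cons -IH -sdiffD; apply: eq_sdiff => x; exact: big_cons.
Qed.

Lemma sall_sub l (Q Q' : V -> bool) m : (forall x, Q x -> Q' x) ->
  sall l Q m -> sall l Q' m.
Proof.
move=> h; elim: l m => [|a l IH] m /=; first exact: h.
by rewrite /sall /= => /andP[/IH ? /IH ?]; apply/andP.
Qed.

Lemma sall_forall (I : Type) l (Q : I -> V -> Prop) m :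
  (forall i, sall l (fun x => `[< Q i x >]) m) ->
  sall l (fun x => `[< forall i, Q i x >]) m.
Proof.
elim: l m => [|a l IH] m h /=.
  by apply/asboolP => i; apply/asboolP; exact: (h i).
by rewrite /sall /=; apply/andP; split; apply: IH => i; have /andP[] := h i.
Qed.

Lemma sdiff_eq0 l f m : sall l (fun x => f x == 0) m -> sdiff l f m = 0.
Proof.
elim: l m => [|a l IH] m /=; first by move/eqP.
rewrite /sall /= => /andP[/IH h1 /IH h2].
by rewrite /sdiff /= -!/(sdiff _ _ _) h1 h2 subrr.
Qed.

End SignFoldNeg.

Section Identity.
Variables (R : realType) (d : nat) (S P : {fset 'rV[R]_d}) (H : 'rV[R]_d).
Hypothesis B : based_roots S P H.
Hypothesis fW : finite_set [set w | weyl S w].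
Implicit Types (X Y Z a b : 'rV[R]_d) (w v : 'M[R]_d).

Lemma word_ind w (Q : 'M[R]_d -> Prop) : Q 1%:M ->
  (forall a v, simple_root P a -> Q v -> Q (refl a *m v)) -> weyl S w -> Q w.
Proof.
move=> Q1 QM /(weyl_simple_word B)[l ls ->].
elim: l ls => //= a l IH ls; apply: QM; first by apply: ls; exact: mem_head.
by apply: IH => x xl; apply: ls; rewrite inE xl orbT.
Qed.

Lemma perm_posD1 a : a \in P -> perm_eq P (a :: P `\ a).
Proof.
move=> aP; apply: uniq_perm => //=; first by rewrite !inE eqxx /=.
by move=> x; rewrite inE !inE; case: eqP => [->|].
Qed.

Lemma perm_simple a : simple_root P a ->
  perm_eq (map (mulmxr (refl a)) (a :: P `\ a)) (- a :: P `\ a).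
Proof.
move=> sa; have [aP _] := sa; rewrite /= mul_refl_self perm_cons.
apply: perm_map_fset; first by move=> x y /= e; rewrite -(mul_reflK x a) e mul_reflK.
move=> b; rewrite !inE => /andP[ba bP] /=; rewrite (simple_refl_pos B) // andbT.
apply/eqP => e; move: (pos_oppN B aP); rewrite -mul_refl_self -[X in X *m _]e mul_reflK.
by rewrite bP.
Qed.

(** Simple reflections permute the other positive roots, and negating one element
    of the list changes the sign of the signed sum. *)
Lemma sdiff_weyl w f : weyl S w ->
  sdiff P (fun x => f (x *m w)) 0 = \det w * sdiff P f 0.
Proof.
move=> ww; elim/word_ind: w / ww f => [|a v sa IH] f.
  by rewrite det1 mul1r; apply: eq_sfold => x; rewrite mulmx1.
have [aP _] := sa.
rewrite det_mulmx det_refl ?(pos_neq0 B) // mulN1r mulNr -IH.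
pose g x := f (x *m v).
rewrite [LHS]/sdiff (eq_sfold _ _ _ (_ : _ =1 g \o mulmxr (refl a))); last first.
  by move=> x; rewrite /g /= mulmxA.
have pm := perm_posD1 aP.
rewrite (perm_sfold (@sub_medial R) _ _ pm) sfold_map; first last.
- by move=> x y; exact: mulmxBl.
- by move=> x y; exact: mulmxDl.
rewrite (perm_sfold (@sub_medial R) _ _ (perm_simple sa)) /= mul0mx.
rewrite -[LHS]/(sdiff (- a :: P `\ a) g 0) sdiff_opp /sdiff.
by rewrite -(perm_sfold (@sub_medial R) _ _ pm).
Qed.

Lemma sall_weyl w (Q : 'rV[R]_d -> bool) : weyl S w ->
  sall P (fun x => Q (x *m w)) 0 = sall P Q 0.
Proof.
move=> ww; elim/word_ind: w / ww Q => [|a v sa IH] Q.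
  by apply: eq_sfold => x; rewrite mulmx1.
have [aP _] := sa.
rewrite -(IH Q).
pose g x := Q (x *m v).
rewrite [LHS]/sall (eq_sfold _ _ _ (_ : _ =1 g \o mulmxr (refl a))); last first.
  by move=> x; rewrite /g /= mulmxA.
have pm := perm_posD1 aP.
rewrite (perm_sfold andb_medial _ _ pm) sfold_map; first last.
- by move=> x y; exact: mulmxBl.
- by move=> x y; exact: mulmxDl.
rewrite (perm_sfold andb_medial _ _ (perm_simple sa)) /= mul0mx.
rewrite -[LHS]/(sall (- a :: P `\ a) g 0) sall_opp /sall.
by rewrite -(perm_sfold andb_medial _ _ pm).
Qed.

(** Membership in the closed positive Weyl chamber. *)
Definition dominant Z := forall b, b \in P -> 0 <= dot b Z.

(** Take the conjugate of maximal height. *)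
Lemma dominant_conj X : exists2 w, weyl S w & dominant (X *m w).
Proof.
have [w ww max] := finite_argmax (fun w => dot (X *m w) H) fW (weyl1 S).
exists w => // b bP.
have := max (w *m refl b) (weyl_mulr ww (weyl_refl (pos_root B bP))).
rewrite mulmxA mul_refl dotBl dotZl gerBl (dotC b (X *m w)) pmulr_lge0 ?(pos_height B) //.
by rewrite pmulr_lge0 ?invr_gt0 ?dot_gt0 ?(pos_neq0 B) // pmulr_rge0 // ltr0n.
Qed.

(** The properties of the points sum e_a a, e_a = +- 1, that single out the sum
    of the positive roots among the dominant regular ones. *)
Definition rho_bounded X :=
  (forall Z, dominant Z -> dot X Z <= dot (rootsum P) Z) /\
  (forall a, simple_root P a -> exists n : int, 2 * dot X a / dot a a = 2 * n%:~R).

Lemma sall_rho_bounded : sall P (fun x => `[< rho_bounded x >]) 0.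
Proof.
suff : forall (l : seq 'rV[R]_d) m, {subset l <= P} ->
    rho_bounded (m + \sum_(b <- l) b) ->
    sall l (fun x => `[< rho_bounded x >]) m.
  apply=> //; rewrite add0r; split=> // a sa; exists 1.
  by rewrite (dot_rootsum_simple B sa) -mulrA divff // dot_eq0 (pos_neq0 B) //; case: sa.
elim=> [|a l IH] m lP; first by rewrite big_nil addr0 => h; apply/asboolP.
have aP : a \in P by apply: lP; exact: mem_head.
have {}lP : {subset l <= P} by move=> x xl; apply: lP; rewrite inE xl orbT.
rewrite big_cons => -[h1 h2]; rewrite /sall /=; apply/andP; split; apply: IH => //.
  by rewrite -addrA; split.
have -> : m - a + \sum_(j <- l) j = (m + (a + \sum_(j <- l) j)) - 2 *: a.
  rewrite scaler_nat mulr2n opprD !addrA (addrAC _ (- a)).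
  by rewrite (addrAC (m + a)) addrK addrAC.
split=> [Z dZ|b sb].
  by rewrite dotBl dotZl lerBlDr (le_trans (h1 _ dZ)) // lerDl mulr_ge0 // dZ.
have [n nE] := h2 b sb; have [bP _] := sb.
have /intrP[k kE] := br_int B (pos_root B bP) (pos_root B aP).
exists (n - k); rewrite dotBl dotZl rmorphB /= [RHS]mulrBr -nE -kE; field.
by rewrite dot_eq0 (pos_neq0 B).
Qed.

(** For a simple root [a], 2 <X, a> / <a, a> is even and positive, so X - rho is
    dominant; then |X - rho|^2 = <X, X - rho> - <rho, X - rho> <= 0. *)
Lemma rho_bounded_dominant X : rho_bounded X ->
  (forall b, b \in P -> 0 < dot b X) -> X = rootsum P.
Proof.
move=> [h1 h2] hX; apply/eqP; rewrite -subr_eq0 -dot_eq0 eq_le dot_ge0 andbT.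
rewrite dotBl subr_le0; apply: h1 => b.
elim/(pos_ind B): b / => [a sa|a b _ _ _ ? ?]; last first.
  by rewrite dotDl addr_ge0.
have [aP _] := sa; have [n nE] := h2 a sa.
have a0 : 0 < dot a a by rewrite dot_gt0 (pos_neq0 B).
have : 0 < 2 * dot X a / dot a a by rewrite divr_gt0 ?mulr_gt0 // dotC hX.
rewrite nE pmulr_rgt0 // ltr0z gtz0_ge1 => n1.
rewrite dotBr (dotC a (rootsum P)) (dot_rootsum_simple B sa) (dotC a X) subr_ge0.
have -> : dot X a = n%:~R * dot a a.
  have -> : dot X a = (2 * dot X a / dot a a) * dot a a / 2.
    by field; rewrite gt_eqF.
  by rewrite nE; field.
by rewrite ler_peMl ?(ltW a0) // -[1]/(1%:~R) ler_int.
Qed.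

(** An anti-invariant function vanishes at singular points, and every regular
    point of the signed sum is conjugate to the sum of the positive roots. *)
Lemma sdiff_anti_eq0 k : (forall w x, weyl S w -> k (x *m w) = \det w * k x) ->
  k (rootsum P) = 0 -> sdiff P k 0 = 0.
Proof.
move=> anti k0; apply: sdiff_eq0.
pose Q (w : {w : 'M[R]_d | weyl S w}) x := rho_bounded (x *m sval w).
have : sall P (fun x => `[< forall i, Q i x >]) 0.
  apply: sall_forall => -[w ww]; rewrite /Q /=.
  by rewrite (sall_weyl (fun x => `[< rho_bounded x >]) ww); exact: sall_rho_bounded.
apply: sall_sub => x /asboolP h; apply/eqP.
have [w ww dw] := dominant_conj x.
suff e : k (x *m w) = 0.
  have := anti w x ww; rewrite e => /esym/eqP; rewrite mulf_eq0 => /orP[/eqP dw0|/eqP//].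
  by have := weyl_det_sqr ww; rewrite dw0 mulr0 => /esym/eqP; rewrite oner_eq0.
have [[b bP e]|nb] := pselect (exists2 b, b \in P & dot b (x *m w) = 0).
  have := anti _ (x *m w) (weyl_refl (pos_root B bP)).
  rewrite mul_refl_fix 1?dotC // det_refl ?(pos_neq0 B) //; lra.
rewrite (@rho_bounded_dominant (x *m w)) //; first exact: (h (exist _ w ww)).
move=> b bP; rewrite lt_neqAle dw // andbT eq_sym; apply/eqP => e.
by apply: nb; exists b.
Qed.

(** An element fixing the sum of the positive roots preserves [P]. *)
Lemma rho_stab w : weyl S w -> rootsum P *m w = rootsum P -> w = 1%:M.
Proof.
move=> ww e; apply: (weyl_pos_stable B ww) => a aP; apply: contrapT => /negP h.
have aS := weyl_root (br_refl B) ww (pos_root B aP).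
have := dot_rootsum_pos B (root_pos_or B aS h).
rewrite dotNr oppr_gt0 -[X in dot X]e (weyl_dot _ _ ww) ltNge ltW //.
exact: (dot_rootsum_pos B).
Qed.

(** Only the choice of all signs + reaches the sum of the positive roots. *)
Lemma sdiff_rho : sdiff P (fun x => (x == rootsum P)%:R) 0 = 1 :> R.
Proof.
suff h : forall (l : seq 'rV[R]_d) (m n : 'rV[R]_d), {subset l <= P} ->
   (dot (m + \sum_(b <- l) b) H < dot n H -> sdiff l (fun x => (x == n)%:R) m = 0 :> R) /\
   (n = m + \sum_(b <- l) b -> sdiff l (fun x => (x == n)%:R) m = 1 :> R).
  by have [_ ->] := h P 0 (rootsum P) (fun x => id); rewrite ?add0r.
elim=> [|a l IH] m n lP.
  rewrite big_nil addr0 /sdiff /=; split=> [h|->]; last by rewrite eqxx.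
  by case: eqP h => // ->; rewrite ltxx.
have aH : 0 < dot a H by apply: (pos_height B); apply: lP; exact: mem_head.
have {}lP : {subset l <= P} by move=> x xl; apply: lP; rewrite inE xl orbT.
rewrite big_cons /sdiff /= -!/(sdiff _ _ _).
have [h1 h2] := IH (m + a) n lP; have [h3 _] := IH (m - a) n lP.
split=> h.
  rewrite h1 -?addrA // h3 ?subrr //; apply: le_lt_trans h.
  by rewrite !dotDl dotNl; lra.
rewrite h2 -?addrA // h3 ?subr0 //.
by rewrite h !dotDl dotNl; lra.
Qed.

Lemma sum_weylf_mull v (F : 'M[R]_d -> R) : weyl S v ->
  \sum_(w <- weylf S) F (v *m w) = \sum_(w <- weylf S) F w.
Proof.
move=> wv; rewrite -(big_map (mulmx v) xpredT F); apply: perm_big.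
apply: perm_map_fset.
  by move=> x y /= /(congr1 (mulmx v^T)); rewrite !mulmxA (weyl_orthl wv) !mul1mx.
by move=> x /(weylfP _ fW) wx; apply/(weylfP _ fW); exact: weyl_mulr.
Qed.

(** Weyl's denominator identity. *)
Lemma weyl_identity (f : 'rV[R]_d -> R) :
  sdiff P f 0 = \sum_(w <- weylf S) \det w * f (rootsum P *m w).
Proof.
pose anti (g : 'rV[R]_d -> R) x := \sum_(w <- weylf S) \det w * g (x *m w).
have antiP g w x : weyl S w -> anti g (x *m w) = \det w * anti g x.
  move=> ww; rewrite /anti -(sum_weylf_mull (fun v => \det v * g (x *m v)) ww) mulr_sumr.
  by apply: eq_bigr => v _; rewrite det_mulmx !mulrA (weyl_det_sqr ww) mul1r mulmxA.
pose card := \sum_(w <- weylf S) (1 : R).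
have antiD g : sdiff P (anti g) 0 = card * sdiff P g 0.
  rewrite sdiff_sum mulr_suml [LHS]big_seq [RHS]big_seq.
  apply: eq_bigr => w /(weylfP _ fW) ww.
  by rewrite sdiffZ sdiff_weyl // mulrA (weyl_det_sqr ww).
have w1 : 1%:M \in weylf S by apply/(weylfP _ fW); exact: weyl1.
have card_neq0 : card != 0.
  rewrite /card (big_fsetD1 1%:M) //= gt_eqF // ltr_pwDl //.
  by rewrite big_seq sumr_ge0.
pose e x : R := (x == rootsum P)%:R.
have e1 : anti e (rootsum P) = 1.
  rewrite /anti (big_fsetD1 1%:M) //= det1 mulmx1 /e eqxx mulr1 big1_fset ?addr0 //.
  move=> w; rewrite !inE => /andP[/eqP w0 /(weylfP _ fW) ww] _.
  by case: eqP => [/(rho_stab ww)//|]; rewrite mulr0.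
(* anti f and anti f (rho) * anti e are anti-invariant and agree at rho *)
have : sdiff P (fun x => anti f x + (- anti f (rootsum P)) * anti e x) 0 = 0.
  apply: sdiff_anti_eq0; last by rewrite e1 mulr1 subrr.
  by move=> w x ww; rewrite !antiP //; ring.
rewrite sdiffD sdiffZ !antiD sdiff_rho mulr1 => h.
rewrite -[RHS]/(anti f (rootsum P)); apply: (mulfI card_neq0).
by apply/eqP; rewrite -subr_eq0 -h; apply/eqP; ring.
Qed.

(** The stabiliser of a dominant vector [Y] is generated by the reflections that
    fix it.  In the coset of [w] modulo these, the element moving [H] to a vector of
    maximal height preserves [P], hence is the identity. *)
Lemma weyl_stab Y w : dominant Y -> weyl S w -> Y *m w = Y ->
  weyl [fset a in S | dot a Y == 0] w.
Proof.
move=> dY ww e; set SY := [fset a in S | _].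
have sub : {subset SY <= S} by move=> x; rewrite !inE => /andP[].
have fY : finite_set [set v | weyl SY v].
  by apply: sub_finite_set fW => v /=; exact: weyl_sub.
have fixY v : weyl SY v -> Y *m v = Y.
  elim=> [|a v']; first by rewrite mulmx1.
  rewrite !inE => /andP[_ /eqP aY] _ IH; rewrite mulmxA mul_refl_fix // dotC //.
have [v wv max] := finite_argmax (fun v => dot (H *m (v *m w)) H) fY (weyl1 SY).
have wvw : weyl S (v *m w) by apply: weyl_mulr => //; exact: weyl_sub wv.
suff vw1 : v *m w = 1%:M.
  have -> : w = v^T by rewrite -[LHS]mul1mx -(weyl_orthl wv) -mulmxA vw1 mulmx1.
  exact: weyl_tr.
apply: (weyl_pos_stable B wvw) => a aP; apply: contrapT => /negP h.
have aS := pos_root B aP.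
have awS := weyl_root (br_refl B) wvw aS.
have naw := root_pos_or B awS h.
have aY : dot a Y = 0.
  apply: le_anti; rewrite dY // andbT.
  have := dY _ naw; rewrite dotNl oppr_ge0.
  by rewrite -{1}e -{1}(fixY v wv) -mulmxA (weyl_dot _ _ wvw).
have aSY : a \in SY by rewrite !inE aS aY eqxx.
have := max _ (weylM aSY wv).
rewrite -(mulmxA (refl a)) mulmxA mul_refl mulmxBl -scalemxAl dotBl dotZl.
rewrite lerBlDr lerDl => h2.
have := pos_height B naw; rewrite dotNl oppr_gt0 ltNge => /negP; apply.
move: h2; rewrite pmulr_rge0 // divr_gt0 ?mulr_gt0 ?dot_gt0 ?(pos_neq0 B) //.
by rewrite dotC (pos_height B).
Qed.

End Identity.

(** * Division by linear forms *)

Lemma affine_neq0_near (R : realType) (u b : R) : b != 0 ->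
  \forall t \near 0^', u + t * b != 0.
Proof.
move=> b0; have [->|u0] := eqVneq u 0.
  near=> t; rewrite add0r mulf_neq0 //; near: t; exact: nbhs_dnbhs_neq.
have hc : u + t * b @[t --> (0 : R)] --> u.
  rewrite -[X in _ --> X]addr0 -[X in _ --> _ + X](mul0r b).
  apply: cvgD; first exact: cvg_cst.
  by apply: cvgM; [exact: cvg_id|exact: cvg_cst].
by apply: nbhs_dnbhs; exact: (cvgr_neq0 u hc u0).
Unshelve. all: by end_near. Qed.

(** Let c be a point of E, and alpha_i linear forms vanishing at c, each with a
    vector v_i such that alpha_i(v_i) = 1, for the indices [i] satisfying [D]. *)
Section Divisible.
Variables (R : realType) (E : normedModType R) (I : Type).
Variables (alpha : I -> E -> R) (v : I -> E) (D : I -> Prop) (c : E).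
Hypothesis alpha_lin : forall i a x y, alpha i (a *: x + y) = a * alpha i x + alpha i y.
Hypothesis alpha_cont : forall i, continuous (alpha i).
Hypothesis alpha_v : forall i, D i -> alpha i (v i) = 1.
Hypothesis alpha_c : forall i, D i -> alpha i c = 0.
Implicit Types (f g : E -> R) (k : nat).

(** Continuity at all the points of a neighbourhood of [c]. *)
Definition nearby_continuous f := \forall z \near c, {for z, continuous f}.

(** The projection onto the kernel of alpha_i along v_i. *)
Definition proj i (z : E) := z - alpha i z *: v i.

(** [divisible k f] allows [k] successive divisions by the linear forms: near [c],
    [f] is continuous, and the difference between [f] and its composite with each
    projection is alpha_i times a function that allows k - 1 divisions. *)
Fixpoint divisible k f : Prop :=
  nearby_continuous f /\
  if k is k'.+1 then
    divisible k' f /\ forall i, D i -> exists2 g, divisible k' g &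
      \forall z \near c, f z - f (proj i z) = alpha i z * g z
  else True.

Lemma divisible_cont k f : divisible k f -> nearby_continuous f.
Proof. by case: k => [|k] []. Qed.

Lemma divisible_cont_at k f : divisible k f -> {for c, continuous f}.
Proof. by move=> /divisible_cont h; exact: (nbhs_singleton h). Qed.

Lemma alphaD i x y : alpha i (x + y) = alpha i x + alpha i y.
Proof. by rewrite -[x in LHS]scale1r alpha_lin mul1r. Qed.

Lemma alphaZ i a x : alpha i (a *: x) = a * alpha i x.
Proof.
have a0 : alpha i 0 = 0 by apply: (addrI (alpha i 0)); rewrite -alphaD !addr0.
by rewrite -[_ *: _]addr0 alpha_lin a0 addr0.
Qed.

Lemma proj_alpha i z : D i -> alpha i (proj i z) = 0.
Proof. by move=> Di; rewrite /proj alphaD -scaleNr alphaZ alpha_v // mulr1 subrr. Qed.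

Lemma proj_c i : D i -> proj i c = c.
Proof. by move=> Di; rewrite /proj alpha_c // scale0r subr0. Qed.

Lemma proj_cvg i : D i -> proj i z @[z --> c] --> c.
Proof.
move=> Di; rewrite -[X in _ --> X](proj_c Di).
by apply: cvgB => //; apply: cvgZl; exact: alpha_cont.
Qed.

Lemma divisible_cst k a : divisible k (fun=> a).
Proof.
elim: k a => [|k IH] a; first by split=> //; near=> z; exact: cvg_cst.
split; first by near=> z; exact: cvg_cst.
split=> // i _; exists (fun=> 0); first exact: IH.
by near=> z; rewrite subrr mulr0.
Unshelve. all: by end_near. Qed.

Lemma divisible_lin k (L : E -> R) : (forall a x y, L (a *: x + y) = a * L x + L y) ->
  continuous L -> divisible k L.
Proof.
move=> Ll Lc; elim: k => [|k IH]; first by split=> //; near=> z; exact: Lc.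
split; first by near=> z; exact: Lc.
split=> // i _; exists (fun=> L (v i)); first exact: divisible_cst.
near=> z; rewrite /proj -scaleNr (addrC z) Ll mulNr; ring.
Unshelve. all: by end_near. Qed.

Lemma divisible_alpha k i : divisible k (alpha i).
Proof. by apply: divisible_lin; [exact: alpha_lin|exact: alpha_cont]. Qed.

Lemma divisibleD k f g : divisible k f -> divisible k g -> divisible k (fun z => f z + g z).
Proof.
elim: k f g => [|k IH] f g [cf hf] [cg hg].
  by split=> //; near=> z; apply: cvgD; near: z.
split; first by near=> z; apply: cvgD; near: z.
have [nf {}hf] := hf; have [ng {}hg] := hg.
split; first exact: IH.
move=> i Di; have [f' nf' ef] := hf i Di; have [g' ng' eg] := hg i Di.
exists (fun z => f' z + g' z); first exact: IH.
near=> z; rewrite opprD addrACA.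
have -> : f z - f (proj i z) = alpha i z * f' z by near: z.
have -> : g z - g (proj i z) = alpha i z * g' z by near: z.
by rewrite mulrDr.
Unshelve. all: by end_near. Qed.

Lemma divisibleM k f g : divisible k f -> divisible k g -> divisible k (fun z => f z * g z).
Proof.
elim: k f g => [|k IH] f g [cf hf] [cg hg].
  by split=> //; near=> z; apply: cvgM; near: z.
split; first by near=> z; apply: cvgM; near: z.
have [nf {}hf] := hf; have [ng {}hg] := hg.
split; first exact: IH.
move=> i Di; have [f' nf' ef] := hf i Di; have [g' ng' eg] := hg i Di.
exists (fun z => f' z * g z + f z * g' z + -1 * (alpha i z * (f' z * g' z))).
  apply: divisibleD; first by apply: divisibleD; exact: IH.
  apply: (IH); first exact: divisible_cst.
  by apply: (IH); [exact: divisible_alpha|exact: IH].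
near=> z.
have e1 : f z - f (proj i z) = alpha i z * f' z by near: z.
have e2 : g z - g (proj i z) = alpha i z * g' z by near: z.
have -> : f (proj i z) = f z - alpha i z * f' z by rewrite -e1; ring.
have -> : g (proj i z) = g z - alpha i z * g' z by rewrite -e2; ring.
by ring.
Unshelve. all: by end_near. Qed.

Lemma divisibleZ k a f : divisible k f -> divisible k (fun z => a * f z).
Proof. by apply: divisibleM; exact: divisible_cst. Qed.

Lemma divisibleB k f g : divisible k f -> divisible k g -> divisible k (fun z => f z - g z).
Proof.
move=> nf ng; have -> : (fun z => f z - g z) = (fun z => f z + -1 * g z).
  by apply/funext => z; rewrite mulN1r.
by apply: divisibleD => //; exact: divisibleZ.
Qed.

(** If [f'] is the quotient given by the definition of [divisible], the function
    below coincides near [c] with the composite of [f] and the projection. *)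
Lemma divisible_shift k i f f' : D i -> divisible k f -> divisible k f' ->
  divisible k (fun z => f z - alpha i z * f' z) /\ f c - alpha i c * f' c = f c.
Proof.
move=> Di nf nf'; rewrite alpha_c // mul0r subr0; split=> //.
by apply: divisibleB => //; apply: divisibleM => //; exact: divisible_alpha.
Qed.

Lemma divisible_inv k f : divisible k f -> f c != 0 -> divisible k (fun z => (f z)^-1).
Proof.
have nz g : {for c, continuous g} -> g c != 0 -> \forall z \near c, g z != 0.
  by move=> cg g0; exact: (cvgr_neq0 (g c)).
elim: k f => [|k IH] f nf f0.
  have [cf _] := nf; split=> //; near=> z; apply: continuousV; last by near: z.
  by near: z; apply: nz => //; exact: divisible_cont_at nf.
have [cf [nf1 hf]] := nf.
split.
  near=> z; apply: continuousV; last by near: z.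
  by near: z; apply: nz => //; exact: divisible_cont_at nf.
split; first exact: IH.
move=> i Di; have [f' nf' ef] := hf i Di.
have [ns es] := divisible_shift Di nf1 nf'.
exists (fun z => -1 * (f' z * ((f z)^-1 * (f z - alpha i z * f' z)^-1))).
  apply: divisibleZ; apply: divisibleM => //; apply: divisibleM; first exact: IH.
  by apply: IH => //; rewrite es.
near=> z.
have e1 : f z - f (proj i z) = alpha i z * f' z by near: z.
have -> : f (proj i z) = f z - alpha i z * f' z by rewrite -e1; ring.
have z1 : f z != 0 by near: z; apply: nz => //; exact: divisible_cont_at nf.
have z2 : f z - alpha i z * f' z != 0.
  near: z; apply: nz; [exact: divisible_cont_at ns|by rewrite es].
by field; rewrite z1 z2.
Unshelve. all: by end_near. Qed.

Lemma divisible_sqrt k f : divisible k f -> 0 < f c -> divisible k (fun z => Num.sqrt (f z)).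
Proof.
have pos g : {for c, continuous g} -> 0 < g c -> \forall z \near c, 0 < g z.
  by move=> cg g0; exact: (cvgr_gt (g c)).
elim: k f => [|k IH] f nf f0.
  have [cf _] := nf; split=> //; near=> z; apply: continuous_comp; first by near: z.
  exact: sqrt_continuous.
have [cf [nf1 hf]] := nf.
split.
  near=> z; apply: continuous_comp; first by near: z.
  exact: sqrt_continuous.
split; first exact: IH.
move=> i Di; have [f' nf' ef] := hf i Di.
have [ns es] := divisible_shift Di nf1 nf'.
exists (fun z => f' z * (Num.sqrt (f z) + Num.sqrt (f z - alpha i z * f' z))^-1).
  apply: divisibleM => //; apply: divisible_inv.
    by apply: divisibleD; apply: IH => //; rewrite es.
  by rewrite es gt_eqF // addr_gt0 // sqrtr_gt0.
near=> z.
have e1 : f z - f (proj i z) = alpha i z * f' z by near: z.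
have -> : f (proj i z) = f z - alpha i z * f' z by rewrite -e1; ring.
have z1 : 0 < f z by near: z; apply: pos => //; exact: divisible_cont_at nf.
have z2 : 0 < f z - alpha i z * f' z.
  near: z; apply: (pos (fun z => f z - alpha i z * f' z)); last by rewrite es.
  exact: divisible_cont_at ns.
set s := Num.sqrt (f z); set t := Num.sqrt _.
have st : s + t != 0 by rewrite gt_eqF // addr_gt0 // sqrtr_gt0.
have -> : alpha i z * (f' z * (s + t)^-1) = (alpha i z * f' z) / (s + t) by rewrite mulrA.
apply: (mulIf st); rewrite divfK //.
have -> : alpha i z * f' z = s ^+ 2 - t ^+ 2.
  by rewrite !sqr_sqrtr ?ltW // opprB addrC subrK.
by ring.
Unshelve. all: by end_near. Qed.

Lemma divisible_sum k (J : Type) (r : seq J) (Q : pred J) (F : J -> E -> R) :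
  (forall j, Q j -> divisible k (F j)) -> divisible k (fun z => \sum_(j <- r | Q j) F j z).
Proof.
move=> h; elim: r => [|j r IH].
  rewrite (_ : (fun _ => _) = fun=> 0); first exact: divisible_cst.
  by apply/funext => z; rewrite big_nil.
case: (boolP (Q j)) => Qj.
  rewrite (_ : (fun _ => _) = fun z => F j z + \sum_(j <- r | Q j) F j z).
    by apply: divisibleD => //; exact: h.
  by apply/funext => z; rewrite big_cons Qj.
rewrite (_ : (fun _ => _) = fun z => \sum_(j <- r | Q j) F j z) //.
by apply/funext => z; rewrite big_cons (negPf Qj).
Qed.

Lemma divisible_prod k (J : Type) (r : seq J) (Q : pred J) (F : J -> E -> R) :
  (forall j, Q j -> divisible k (F j)) -> divisible k (fun z => \prod_(j <- r | Q j) F j z).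
Proof.
move=> h; elim: r => [|j r IH].
  rewrite (_ : (fun _ => _) = fun=> 1); first exact: divisible_cst.
  by apply/funext => z; rewrite big_nil.
case: (boolP (Q j)) => Qj.
  rewrite (_ : (fun _ => _) = fun z => F j z * \prod_(j <- r | Q j) F j z).
    by apply: divisibleM => //; exact: h.
  by apply/funext => z; rewrite big_cons Qj.
rewrite (_ : (fun _ => _) = fun z => \prod_(j <- r | Q j) F j z) //.
by apply/funext => z; rewrite big_cons (negPf Qj).
Qed.

Lemma divisible_exp k n f : divisible k f -> divisible k (fun z => f z ^+ n).
Proof.
move=> nf; elim: n => [|n IH]; first exact: divisible_cst.
rewrite (_ : (fun _ => _) = fun z => f z * f z ^+ n); first exact: divisibleM.
by apply/funext => z; rewrite exprS.
Qed.

Lemma cont_eq_dnbhs (h : R -> R) (a : R) : h t @[t --> 0] --> h 0 ->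
  (\forall t \near 0^', h t = a) -> h 0 = a.
Proof.
move=> /continuous_withinNx hc ha.
have ha' : h t @[t --> 0^'] --> a.
  apply: cvg_trans (near_eq_cvg (f := fun=> a) _) (cvg_cst a).
  by near=> t; rewrite /= -(_ : h t = a) //; near: t.
exact: (cvg_unique _ hc ha').
Unshelve. all: by end_near. Qed.



(** A function vanishing on the kernels of pairwise independent forms is divisible
    by their product: the quotient by the first form vanishes on the other
    kernels, by continuity from the points where the first form is not zero. *)
Lemma divisible_div l f :
  (forall i, List.In i l -> D i) ->
  List.ForallOrdPairs (fun i j => exists u, alpha i u = 1 /\ alpha j u = 0) l ->
  divisible (size l) f ->
  (forall i, List.In i l -> \forall z \near c, alpha i z = 0 -> f z = 0) ->
  exists2 g, nearby_continuous g &
    \forall z \near c, f z = (\prod_(i <- l) alpha i z) * g z.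
Proof.
elim: l f => [|i l IH] f Dl ind nf f0.
  by exists f; [exact: divisible_cont nf|near=> z; rewrite big_nil mul1r].
have Di : D i by apply: Dl; left.
have [_ [_ /(_ i Di)[g ng eg]]] := nf.
have fg : \forall z \near c, f z = alpha i z * g z.
  have h : \forall z \near c, f (proj i z) = 0.
    have f0i := f0 i (or_introl erefl).
    have h := @proj_cvg i Di _ f0i.
    near=> z; have : alpha i (proj i z) = 0 -> f (proj i z) = 0 by near: z; exact: h.
    by apply; exact: proj_alpha.
  near=> z; have <- : f z - f (proj i z) = alpha i z * g z by near: z.
  by rewrite (_ : f (proj i z) = 0) ?subr0 //; near: z.
inversion_clear ind as [|? ? indi indl].
have [|j jl|g' cg' eg'] := IH g _ indl ng.
- by move=> j jl; apply: Dl; right.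
- move/List.Forall_forall : indi => /(_ j jl)[u [iu ju]].
  have fj := f0 j (or_intror jl).
  have cg := divisible_cont ng.
  near=> z => jz.
  have cz : {for z, continuous g} by near: z.
  have cl : z + t *: u @[t --> (0 : R)] --> z.
    rewrite -[X in _ --> X]addr0 -[X in _ --> z + X](scale0r u).
    by apply: cvgD; [exact: cvg_cst|apply: cvgZl; exact: cvg_id].
  have h1 : g (z + t *: u) @[t --> (0:R)] --> g (z + 0 *: u).
    by rewrite scale0r addr0; exact: (cvg_comp (fun t : R => z + t *: u) g cl cz).
  have := @cont_eq_dnbhs (fun t => g (z + t *: u)) 0 h1.
  rewrite scale0r addr0; apply.
  pose Q y := (f y = alpha i y * g y) /\ (alpha j y = 0 -> f y = 0).
  have nn : \forall y \near z, Q y.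
    by near: z; apply: near_join; near=> y; split; near: y.
  have nt : \forall t \near (0:R)^', Q (z + t *: u).
    by apply: cvg_within; exact: (cl _ nn).
  near=> t.
  have [e1 e2] : Q (z + t *: u) by near: t.
  have {e2} e3 : f (z + t *: u) = 0 by apply: e2; rewrite alphaD alphaZ jz ju mulr0 addr0.
  move: e1; rewrite e3 => /esym/eqP; rewrite mulf_eq0 => /orP[|/eqP//].
  rewrite alphaD alphaZ iu mulr1 => /eqP e.
  exfalso; move: e; apply/eqP; rewrite -[t]mulr1; near: t.
  by apply: affine_neq0_near; rewrite oner_eq0.
exists g' => //; near=> z; rewrite big_cons -mulrA.
have <- : g z = (\prod_(j <- l) alpha j z) * g' z by near: z.
by near: z.
Unshelve. all: by end_near. Qed.

End Divisible.

(** * Orbit sums of the kernel are divisible by the roots *)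

Lemma near_forall_seq (T : eqType) (U : Type) (F : set_system U) (FF : Filter F)
    (s : seq T) (Q : T -> U -> Prop) :
  (forall x, x \in s -> \forall z \near F, Q x z) ->
  \forall z \near F, forall x, x \in s -> Q x z.
Proof.
elim: s => [|y s IH] h; first by near=> z.
have hy : \forall z \near F, Q y z by apply: h; exact: mem_head.
have hs : \forall z \near F, forall x, x \in s -> Q x z.
  by apply: IH => x xs; apply: h; rewrite inE xs orbT.
near=> z => x; rewrite inE => /predU1P[->|]; first by near: z.
by move: x; near: z.
Unshelve. all: by end_near. Qed.

Section LogQuotient.
Variable R : realType.

(** The difference quotient of the logarithm at 1, with its limit 1 there. *)
Definition lnq (t : R) : R := if t == 1 then 1 else ln t / (t - 1).

Lemma lnqE t : ln t = (t - 1) * lnq t.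
Proof.
rewrite /lnq; case: eqP => [->|/eqP t1]; first by rewrite ln1 subrr mul0r.
by rewrite mulrC divfK // subr_eq0.
Qed.

Lemma lnq_continuous t : 0 < t -> {for t, continuous lnq}.
Proof.
move=> t0; have [->|t1] := eqVneq t 1.
  have e1 : lnq 1 = 1 by rewrite /lnq eqxx.
  change (lnq s @[s --> (1 : R)] --> lnq 1); rewrite e1.
  have hc e : 1 + e * `|s^-1 - 1| @[s --> (1 : R)] --> (1 : R).
    have h : s^-1 @[s --> (1 : R)] --> (1 : R).
      rewrite -[X in _ --> X]invr1; apply: cvgV; [by rewrite oner_eq0|exact: cvg_id].
    rewrite [X in _ --> X](_ : 1 = 1 + e * `|1 - 1|); last first.
      by rewrite subrr normr0 mulr0 addr0.
    apply: cvgD; first exact: cvg_cst.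
    apply: cvgM; first exact: cvg_cst.
    by apply: cvg_norm; apply: cvgB => //; exact: cvg_cst.
  apply: (squeeze_cvgr _ (hc (-1)) (hc 1)).
  near=> s; rewrite mulN1r mul1r -ler_distl.
  have s0 : 0 < s by near: s; exact: lt_nbhsr.
  rewrite /lnq; case: eqP => [_|/eqP s1]; first by rewrite subrr normr0.
  have n0 : 0 < `|s - 1| by rewrite normr_gt0 subr_eq0.
  have l1 : ln s <= s - 1.
    by have := @le_ln1Dx R (s - 1); rewrite addrCA subrr addr0; apply; lra.
  have l2 : - ln s <= s^-1 - 1.
    have si0 : 0 < s^-1 by rewrite invr_gt0.
    rewrite -lnV //; have := @le_ln1Dx R (s^-1 - 1).
    by rewrite addrCA subrr addr0; apply; lra.
  have -> : ln s / (s - 1) - 1 = (ln s - (s - 1)) / (s - 1).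
    by rewrite mulrBl divff // subr_eq0.
  rewrite normrM normfV ler_pdivrMr // ler0_norm ?subr_le0 //.
  have -> : s^-1 - 1 = - ((s - 1) / s) by field; rewrite gt_eqF.
  rewrite normrN normrM normfV (gtr0_norm s0) mulrAC -expr2 real_normK ?num_real //.
  have -> : (s - 1) ^+ 2 / s = (s - 1) + (s^-1 - 1) by field; rewrite gt_eqF.
  lra.
have hc : ln s / (s - 1) @[s --> t] --> ln t / (t - 1).
  apply: cvgM; first exact: continuous_ln.
  apply: cvgV; first by rewrite subr_eq0.
  by apply: cvgB; [exact: cvg_id|exact: cvg_cst].
have et : lnq t = ln t / (t - 1) by rewrite /lnq (negPf t1).
change (lnq s @[s --> t] --> lnq t); rewrite et.
apply: cvg_trans hc; apply: near_eq_cvg; near=> s.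
rewrite /lnq ifF //; apply/negbTE; rewrite -subr_eq0; near: s.
apply: (cvgr_neq0 (t - 1)); last by rewrite subr_eq0.
by apply: cvgB; [exact: cvg_id|exact: cvg_cst].
Unshelve. all: by end_near. Qed.

End LogQuotient.

(** The radial kernel whose alternating sums define the Newton kernel. *)
Definition kern (R : realType) (d : nat) (Z : 'rV[R]_d) : R :=
  if d == 2%N then ln (enorm Z) else (enorm Z ^+ (d - 2))^-1.

Section Division.
Variables (R : realType) (d : nat).
Implicit Types (X Y Z a b : 'rV[R]_d) (w v : 'M[R]_d).
Notation E := ('rV[R]_d * 'rV[R]_d)%type.

(** The linear forms on pairs (X, Y): pairing of a vector with X, for the index
    [(true, a)], or with Y, for the index [(false, a)]. *)
Definition wform (i : bool * 'rV[R]_d) (z : E) : R :=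
  dot i.2 (if i.1 then z.1 else z.2).

(** A vector on which the form of the same index is 1. *)
Definition wdir (i : bool * 'rV[R]_d) : E :=
  let u := (dot i.2 i.2)^-1 *: i.2 in if i.1 then (u, 0) else (0, u).

Lemma wform_lin i c x y : wform i (c *: x + y) = c * wform i x + wform i y.
Proof. by rewrite /wform; case: i.1; rewrite /= dotDr dotZr. Qed.

Lemma coord_fst_cont i : continuous (fun z : E => z.1 0 i).
Proof.
by move=> z; apply: (cvg_comp (fun z : E => z.1) (fun X : 'rV[R]_d => X 0 i));
  [exact: cvg_fst|exact: coord_continuous].
Qed.

Lemma coord_snd_cont i : continuous (fun z : E => z.2 0 i).
Proof.
by move=> z; apply: (cvg_comp (fun z : E => z.2) (fun X : 'rV[R]_d => X 0 i));
  [exact: cvg_snd|exact: coord_continuous].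
Qed.

Lemma dot_continuous a : continuous (dot a).
Proof.
apply: continuous_big => [|i _ X]; first exact: add_continuous.
apply: (@continuousM _ _ (fun=> a 0 i) (fun X : 'rV[R]_d => X 0 i) X).
  exact: cst_continuous.
exact: coord_continuous.
Qed.

Lemma wform_cont i : continuous (wform i).
Proof.
case: i => [[] a] z.
  by apply: (cvg_comp (fun z : E => z.1) (dot a)); [exact: cvg_fst|exact: dot_continuous].
by apply: (cvg_comp (fun z : E => z.2) (dot a)); [exact: cvg_snd|exact: dot_continuous].
Qed.

Section Base.
Variable c : E.
Let D i := i.2 != 0 /\ wform i c = 0.

Lemma wform_dir_gen e a : a != 0 -> wform (e, a) (wdir (e, a)) = 1.
Proof.
by move=> a0; rewrite /wform /wdir; case: e => /=; rewrite dotZr mulVf // dot_eq0.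
Qed.

Lemma wform_dir i : D i -> wform i (wdir i) = 1.
Proof.
case: i => [e a] [/= a0 _]; rewrite /wform /wdir.
by case: e => /=; rewrite dotZr mulVf // dot_eq0.
Qed.

Notation divisible := (divisible wform wdir D c).

Lemma divisible_fst k i : divisible k (fun z : E => z.1 0 i).
Proof. by apply: divisible_lin; [move=> ? ? ?; rewrite !mxE|exact: coord_fst_cont]. Qed.

Lemma divisible_snd k i : divisible k (fun z : E => z.2 0 i).
Proof. by apply: divisible_lin; [move=> ? ? ?; rewrite !mxE|exact: coord_snd_cont]. Qed.

(** The squared distance between X and w . Y. *)
Definition sqd w (z : E) := dot (z.1 - z.2 *m w) (z.1 - z.2 *m w).

Lemma divisible_sqd k w : divisible k (sqd w).
Proof.
rewrite (_ : sqd w = fun z : E => \sum_(i < d)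
   ((z.1 0 i - \sum_j z.2 0 j * w j i) * (z.1 0 i - \sum_j z.2 0 j * w j i))); last first.
  by apply/funext => z; apply: eq_bigr => i _; rewrite !mxE.
have al := wform_lin; have ac := wform_cont; have ad := wform_dir.
have a0 i : D i -> wform i c = 0 by case.
apply: divisible_sum => // i _.
have h : divisible k (fun z : E => z.1 0 i - \sum_j z.2 0 j * w j i).
  apply: divisibleB => //; first exact: divisible_fst.
  apply: divisible_sum => // j _; apply: divisibleM => //; first exact: divisible_snd.
  exact: divisible_cst.
exact: divisibleM.
Qed.

Lemma rootprod_continuous_sub (Q : {fset 'rV[R]_d}) (T : pred 'rV[R]_d) :
  continuous (fun X : 'rV[R]_d => \prod_(a <- Q | T a) dot a X).
Proof.
apply: continuous_big => [|a _]; first exact: mul_continuous.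
exact: dot_continuous.
Qed.

Lemma list_inP (T : eqType) (x : T) s : List.In x s <-> x \in s.
Proof.
elim: s => //= y s IH; rewrite inE; split=> [[->|/IH ->]|/predU1P[->|/IH]].
- by rewrite eqxx.
- by rewrite orbT.
- by left.
- by right.
Qed.

Lemma uniq_ForallOrdPairs (T : eqType) (r : T -> T -> Prop) s : uniq s ->
  (forall x y, x \in s -> y \in s -> x != y -> r x y) -> List.ForallOrdPairs r s.
Proof.
elim: s => [|x s IH] /=; first by constructor.
move=> /andP[xs us] h; constructor.
  apply/List.Forall_forall => y /list_inP ys; apply: h; rewrite ?inE ?eqxx ?ys ?orbT //.
  by apply: contraNneq xs => ->.
by apply: IH => // y z ys zs; apply: h; rewrite inE ?ys ?zs orbT.
Qed.

(** Division by the forms that vanish at [c]; the other ones are invertible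
    there. *)
Lemma wform_div (Q : {fset 'rV[R]_d}) (f : E -> R) :
  (forall a, a \in Q -> a != 0) ->
  (forall a b, a \in Q -> b \in Q -> a != b -> exists u, dot a u = 1 /\ dot b u = 0) ->
  (forall k, divisible k f) ->
  (forall a z, a \in Q -> dot a z.1 = 0 \/ dot a z.2 = 0 -> f z = 0) ->
  exists2 g, nearby_continuous c g &
    \forall z \near c, f z = rootprod Q z.1 * rootprod Q z.2 * g z.
Proof.
move=> Q0 Qind nf f0.
pose l1 := [seq a <- Q | dot a c.1 == 0]; pose l2 := [seq a <- Q | dot a c.2 == 0].
pose l := map (pair true) l1 ++ map (pair false) l2.
have inl e a : (e, a) \in l -> a \in Q /\ wform (e, a) c = 0.
  by rewrite mem_cat => /orP[] /mapP[b]; rewrite mem_filter => /andP[/eqP h bQ] [-> ->].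
have ul : uniq l.
  rewrite cat_uniq !map_inj_uniq ?filter_uniq ?fset_uniq //=; try by move=> ? ? [].
  by rewrite andbT; apply/hasPn => -[e a] /mapP[b _ [-> ->]]; apply/mapP => -[].
have [g cg eg] : exists2 g, nearby_continuous c g &
    \forall z \near c, f z = (\prod_(i <- l) wform i z) * g z.
  apply: (divisible_div wform_lin wform_cont wform_dir (fun i (h : D i) => h.2)) => //.
  - by move=> [e a] /list_inP/inl[aQ ?]; split=> //; exact: Q0.
  - apply: (uniq_ForallOrdPairs ul) => -[e a] [e' b] /inl[aQ _] /inl[bQ _] ne.
    have [ee'|ee'] := eqVneq e e'.
      have ab : a != b by move: ne; rewrite ee' xpair_eqE eqxx.
      have [u [u1 u2]] := Qind a b aQ bQ ab.
      by exists (if e then (u, 0) else (0, u)); rewrite -ee' /wform; case: (e).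
    exists (wdir (e, a)); rewrite wform_dir_gen ?Q0 //; split=> //.
    by move: ee'; rewrite /wform /wdir; case: (e); case: (e') => //= _; rewrite dot0r.
  - move=> [e a] /list_inP/inl[aQ _]; near=> z => h; apply: (f0 a) => //.
    by move: h; rewrite /wform; case: (e) => /= ?; [left|right].
pose q1 (X : 'rV[R]_d) := \prod_(a <- Q | dot a c.1 != 0) dot a X.
pose q2 (X : 'rV[R]_d) := \prod_(a <- Q | dot a c.2 != 0) dot a X.
pose r1 (z : E) := q1 z.1; pose r2 (z : E) := q2 z.2.
have r1c z : {for z, continuous r1}.
  by apply: (cvg_comp (fun z : E => z.1) q1);
    [exact: cvg_fst|exact: rootprod_continuous_sub].
have r2c z : {for z, continuous r2}.
  by apply: (cvg_comp (fun z : E => z.2) q2);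
    [exact: cvg_snd|exact: rootprod_continuous_sub].
have r0 : r1 c * r2 c != 0.
  by rewrite mulf_neq0 // prodf_seq_neq0; apply/allP => a _; apply/implyP.
have rc z : {for z, continuous (fun z => r1 z * r2 z)} by apply: continuousM.
have rn : \forall z \near c, r1 z * r2 z != 0 by exact: (cvgr_neq0 _ (rc c) r0).
exists (fun z => g z / (r1 z * r2 z)).
  near=> z; apply: (@continuousM _ _ g (fun z => (r1 z * r2 z)^-1)); first by near: z.
  by apply: continuousV; [near: z|exact: rc].
near=> z; have -> : f z = (\prod_(i <- l) wform i z) * g z by near: z.
have rz : r1 z * r2 z != 0 by near: z.
have -> : rootprod Q z.1 = \prod_(a <- l1) dot a z.1 * r1 z.
  by rewrite /rootprod (bigID (fun a => dot a c.1 == 0)) /= /l1 big_filter.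
have -> : rootprod Q z.2 = \prod_(a <- l2) dot a z.2 * r2 z.
  by rewrite /rootprod (bigID (fun a => dot a c.2 == 0)) /= /l2 big_filter.
rewrite big_cat !big_map /= [\prod_(j <- l1) _](_ : _ = \prod_(a <- l1) dot a z.1) //.
rewrite [\prod_(j <- l2) _](_ : _ = \prod_(a <- l2) dot a z.2) //.
have [r1z r2z] : r1 z != 0 /\ r2 z != 0 by move: rz; rewrite mulf_eq0 => /norP.
by field; rewrite r1z r2z.
Unshelve. all: by end_near. Qed.
End Base.

Lemma enorm_sqr (Z : 'rV[R]_d) : enorm Z ^+ 2 = dot Z Z.
Proof. by rewrite sqr_sqrtr // dot_ge0. Qed.

Lemma ln_enorm (Z : 'rV[R]_d) : Z != 0 -> ln (enorm Z) = 2^-1 * ln (dot Z Z).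
Proof.
move=> Z0; rewrite -enorm_sqr lnXn ?sqrtr_gt0 ?dot_gt0 //.
by rewrite [ln _ *+ 2]mulr2n; lra.
Qed.

Lemma ln_prod (T : eqType) (s : seq T) (Q : pred T) (F : T -> R) :
  (forall x, x \in s -> Q x -> 0 < F x) ->
  0 < \prod_(x <- s | Q x) F x /\
  ln (\prod_(x <- s | Q x) F x) = \sum_(x <- s | Q x) ln (F x).
Proof.
elim: s => [|x s IH] h; first by rewrite !big_nil ln1.
have [y ys|p e] := IH; first by apply: h; rewrite inE ys orbT.
rewrite !big_cons; case: ifP => // Qx.
have Fx : 0 < F x by apply: h => //; exact: mem_head.
by rewrite mulr_gt0 // lnM ?posrE // e.
Qed.

(** A sum of det(w) K(X - w . Y) over a set [V] stable on both sides under the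
    reflections in [Q] is divisible by the product of [Q] in X and in Y, near a pair
    [c] at which no term has a pole. *)
Lemma kernel_sum_div (Q : {fset 'rV[R]_d}) (V : {fset 'M[R]_d}) (c : E) :
  (forall a, a \in Q -> a != 0) ->
  (forall a b, a \in Q -> b \in Q -> a != b -> exists u, dot a u = 1 /\ dot b u = 0) ->
  (forall a w, a \in Q -> w \in V -> refl a *m w \in V) ->
  (forall a w, a \in Q -> w \in V -> w *m refl a \in V) ->
  (forall w, w \in V -> \det w * \det w = 1) ->
  (forall w, w \in V -> c.1 != c.2 *m w) ->
  exists2 g, nearby_continuous c g &
    \forall z \near c, \sum_(w <- V) \det w * kern (z.1 - z.2 *m w) =
      rootprod Q z.1 * rootprod Q z.2 * g z.
Proof.
move=> Q0 Qind Vl Vr Vdet Vc.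
(* on a wall, multiplication by the reflection pairs off the elements of V
   with equal distances and opposite signs *)
have wall a z : a \in Q -> dot a z.1 = 0 \/ dot a z.2 = 0 ->
    exists s : 'M[R]_d -> 'M[R]_d, [/\ injective s, forall w, w \in V -> s w \in V,
      forall w, \det (s w) = - \det w & forall w, sqd (s w) z = sqd w z].
  move=> aQ [h|h].
    exists (mulmxr (refl a)); split.
    - move=> x y /= e; rewrite -(mulmx1 x) -(refl_sqr a) mulmxA e.
      by rewrite -mulmxA refl_sqr mulmx1.
    - by move=> w /=; exact: Vr.
    - by move=> w /=; rewrite det_mulmx det_refl ?Q0 // mulrN1.
    move=> w; rewrite /sqd /= -{1 2}(@mul_refl_fix _ _ z.1 a) 1?dotC // mulmxA -mulmxBl.
    by rewrite dot_refl mul_reflK.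
  exists (mulmx (refl a)); split.
  - move=> x y /= e; rewrite -(mul1mx x) -(refl_sqr a) -mulmxA e.
    by rewrite mulmxA refl_sqr mul1mx.
  - by move=> w /=; exact: Vl.
  - by move=> w /=; rewrite det_mulmx det_refl ?Q0 // mulN1r.
  by move=> w; rewrite /sqd mulmxA mul_refl_fix // dotC.
have pos w : w \in V -> 0 < sqd w c by move=> wV; rewrite dot_gt0 subr_eq0 Vc.
pose D i := i.2 != 0 /\ wform i c = 0.
have dir i : D i -> wform i (wdir i) = 1 := @wform_dir c i.
have al i : D i -> wform i c = 0 by case.
have nsq k w : divisible wform wdir D c k (sqd w) by exact: divisible_sqd.
have [d2|d2] := eqVneq d 2%N; last first.
  (* the condition w \in V is kept because only these terms have no pole at c *)
  pose f (z : E) := \sum_(w <- V | w \in V) \det w * (Num.sqrt (sqd w z) ^+ (d - 2))^-1.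
  have [k|a z aQ h|g cg eg] := @wform_div c Q f Q0 Qind.
  - apply: divisible_sum => w wV; apply: divisibleZ => //; first exact: wform_lin.
      exact: wform_cont.
    apply: divisible_inv => //; [exact: wform_lin|exact: wform_cont| |].
      apply: divisible_exp => //; [exact: wform_lin|exact: wform_cont|].
      apply: divisible_sqrt => //; [exact: wform_lin|exact: wform_cont|].
      exact: pos.
    by rewrite expf_neq0 // gt_eqF // sqrtr_gt0 pos.
  - have [s [si sV sd sq]] := wall a z aQ h.
    have : f z = - f z; last by lra.
    rewrite {1}/f -big_seq (perm_big _ (_ : perm_eq _ (map s V))) /=; last first.
      by rewrite perm_sym; exact: perm_map_fset.
    rewrite big_map -sumrN -big_seq; apply: eq_bigr => w _.
    by rewrite sd sq mulNr.
  exists g => //; near=> z.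
  have <- : f z = rootprod Q z.1 * rootprod Q z.2 * g z by near: z.
  by rewrite /f -big_seq; apply: eq_bigr => w _; rewrite /kern (negPf d2).
(* d = 2: the sum is ln (A / B) / 2, and A - B is a polynomial *)
pose A (z : E) := \prod_(w <- V | \det w == 1) sqd w z.
pose B (z : E) := \prod_(w <- V | \det w != 1) sqd w z.
have n1 : (- 1 == 1 :> R) = false by apply/eqP; lra.
have detN w : w \in V -> (- \det w == 1) = (\det w != 1).
  move=> /Vdet; rewrite -expr2 => /eqP; rewrite sqrf_eq1 => /orP[] /eqP ->.
    by rewrite eqxx n1.
  by rewrite opprK n1 eqxx.
have nA k : divisible wform wdir D c k A.
  by apply: divisible_prod => //; [exact: wform_lin|exact: wform_cont].
have nB k : divisible wform wdir D c k B.
  by apply: divisible_prod => //; [exact: wform_lin|exact: wform_cont].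
have [k|a z aQ h|g cg eg] := @wform_div c Q (fun z => A z - B z) Q0 Qind.
- by apply: divisibleB => //; [exact: wform_lin|exact: wform_cont].
- have [s [si sV sd sq]] := wall a z aQ h.
  apply/eqP; rewrite subr_eq0; apply/eqP.
  rewrite /A (perm_big _ (_ : perm_eq _ (map s V))) /=; last first.
    by rewrite perm_sym; exact: perm_map_fset.
  rewrite big_map big_seq_cond [RHS]big_seq_cond; apply: eq_big => w.
    by case: (boolP (w \in V)) => //= wV; rewrite sd detN.
  by rewrite sq.
have k2 Z : kern Z = ln (enorm Z) by rewrite /kern ifT //; apply/eqP.
have cA := divisible_cont (nA 0%N); have cB := divisible_cont (nB 0%N).
have Vpos z : (forall w, w \in V -> 0 < sqd w z) -> 0 < A z /\ 0 < B z /\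
    \sum_(w <- V) \det w * kern (z.1 - z.2 *m w) =
    2^-1 * ((A z - B z) * (lnq (A z / B z) / B z)).
  move=> h.
  have [pA lA] := @ln_prod _ V (fun w => \det w == 1) (fun w => sqd w z)
    (fun w wV _ => h w wV).
  have [pB lB] := @ln_prod _ V (fun w => \det w != 1) (fun w => sqd w z)
    (fun w wV _ => h w wV).
  split=> //; split=> //.
  have -> : (A z - B z) * (lnq (A z / B z) / B z) = (A z / B z - 1) * lnq (A z / B z).
    by field; rewrite gt_eqF.
  rewrite -lnqE ln_div ?posrE // /A /B lA lB mulrBr !mulr_sumr.
  rewrite (bigID (fun w => \det w == 1)) /= -sumrN; congr (_ + _).
    rewrite big_seq_cond [RHS]big_seq_cond; apply: eq_bigr => w /andP[wV /eqP ->].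
    by rewrite k2 mul1r ln_enorm // -dot_gt0; exact: h.
  rewrite big_seq_cond [RHS]big_seq_cond; apply: eq_bigr => w /andP[wV].
  rewrite -detN // => /eqP e; have -> : \det w = - 1 by rewrite -e opprK.
  by rewrite mulN1r k2 ln_enorm // -dot_gt0; exact: h.
have np : \forall z \near c, forall w, w \in V -> 0 < sqd w z.
  apply: (@near_forall_seq _ _ (nbhs c) _ V (fun w z => 0 < sqd w z)) => w wV.
  exact: (cvgr_gt (sqd w c) (divisible_cont_at (nsq 0%N w)) _ (pos w wV)).
exists (fun z => 2^-1 * (g z * (lnq (A z / B z) / B z))); last first.
  near=> z; have [pA [pB ->]] : 0 < A z /\ 0 < B z /\
    \sum_(w <- V) \det w * kern (z.1 - z.2 *m w) =
    2^-1 * ((A z - B z) * (lnq (A z / B z) / B z)).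
    by apply: Vpos; near: z.
  have -> : A z - B z = rootprod Q z.1 * rootprod Q z.2 * g z by near: z.
  by ring.
near=> z.
have [pA [pB _]] : 0 < A z /\ 0 < B z /\
    \sum_(w <- V) \det w * kern (z.1 - z.2 *m w) =
    2^-1 * ((A z - B z) * (lnq (A z / B z) / B z)).
  by apply: Vpos; near: z.
have cAz : {for z, continuous A} by near: z.
have cBz : {for z, continuous B} by near: z.
have cBi : {for z, continuous (fun z => (B z)^-1)}.
  by apply: continuousV => //; rewrite gt_eqF.
apply: cvgM; first exact: cvg_cst.
apply: cvgM; first by near: z.
apply: cvgM => //.
have h1 : (fun y => A y / B y) @ z --> A z / B z by exact: cvgM.
have h2 : {for A z / B z, continuous (@lnq R)} by apply: lnq_continuous; rewrite divr_gt0.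
exact: (cvg_comp (fun y => A y / B y) (@lnq R) h1 h2).
Unshelve. all: by end_near. Qed.

End Division.

(** * Leading coefficient of an orbit sum *)

Section Mean.
Variables (R : realType) (phi : nat -> R -> R).
Hypothesis phiD : forall (k : nat) (s : R), 0 < s -> is_derive s 1 (phi k) (phi k.+1 s).
Implicit Types (l : seq R).

Definition abs_sum l : R := \sum_(h <- l) `|h|.

Lemma abs_sum_cons a l : abs_sum (a :: l) = `|a| + abs_sum l.
Proof. exact: big_cons. Qed.

Lemma is_derive_sdiff l k (s : R) : abs_sum l < s ->
  is_derive s 1 (sdiff l (phi k)) (sdiff l (phi k.+1) s).
Proof.
elim: l s => [|a l IH] s.
  by rewrite /abs_sum big_nil => s0; exact: phiD.
rewrite abs_sum_cons => h.
have shift b : `|b| <= `|a| -> is_derive s 1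
    (fun y => sdiff l (phi k) (y + b)) (sdiff l (phi k.+1) (s + b)).
  move=> ba.
  have d1 : is_derive (s + b) 1 (sdiff l (phi k)) (sdiff l (phi k.+1) (s + b)).
    apply: IH; have := ler_norm (- b); rewrite normrN; lra.
  have d2 : is_derive s 1 (fun y : R => y + b) 1.
    by apply: is_derive_eq; rewrite addr0.
  have := @is_derive1_comp R (sdiff l (phi k)) (fun y => y + b) s _ _ d1 d2.
  by rewrite mulr1.
have d1 := shift a (lexx _).
have d2 : is_derive s 1 (fun y => sdiff l (phi k) (y - a)) (sdiff l (phi k.+1) (s - a)).
  by apply: shift; rewrite normrN.
exact: is_deriveB.
Qed.

(** The mean value theorem for an iterated symmetric difference, one derivative
    for each step. *)
Lemma sdiff_mean l k (s : R) : abs_sum l < s -> exists2 x, `|x - s| <= abs_sum l &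
  sdiff l (phi k) s = \prod_(h <- l) (2 * h) * phi (k + size l)%N x.
Proof.
elim: l k s => [|a l IH] k s.
  move=> _; exists s; first by rewrite subrr normr0 /abs_sum big_nil.
  by rewrite big_nil mul1r addn0.
rewrite !abs_sum_cons => h.
have pos (y : R) : `|y - s| <= `|a| -> abs_sum l < y.
  by rewrite ler_norml => /andP[h1 h2]; lra.
have dF (y : R) : `|y - s| <= `|a| ->
    is_derive y 1 (sdiff l (phi k)) (sdiff l (phi k.+1) y).
  by move=> /pos; exact: is_derive_sdiff.
have inI (y : R) : y \in `[s - `|a|, s + `|a|] -> `|y - s| <= `|a|.
  by rewrite in_itv /= => /andP[h1 h2]; rewrite ler_norml; apply/andP; split; lra.
have [y yI e] : exists2 y, y \in `[s - `|a|, s + `|a|] &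
    sdiff l (phi k) (s + `|a|) - sdiff l (phi k) (s - `|a|) =
    sdiff l (phi k.+1) y * (s + `|a| - (s - `|a|)).
  apply: MVT_segment.
  - by have := normr_ge0 a; lra.
  - by move=> y yI; apply: dF; apply: inI; exact: subset_itv_oo_cc.
  - apply: derivable_within_continuous => y /inI/dF dy; exact: ex_derive.
have [x xy ex] := IH k.+1 y (pos y (inI y yI)).
exists x.
  have := inI y yI; have := ler_normD (x - y) (y - s); rewrite addrA subrK; lra.
rewrite /sdiff /= -!/(sdiff _ _ _) big_cons /= addnS -addSn -mulrA -ex.
have [a0|a0] := lerP 0 a.
  by move: e; rewrite ger0_norm // => ->; ring.
by move: e; rewrite ltr0_norm // opprK => e; apply: oppr_inj; rewrite opprB e; ring.
Qed.

End Mean.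

(** The k-th derivative on s > 0 of the function phi such that K(Z) = phi(|Z|^2):
    phi(s) = ln(s) / 2 if d = 2 and phi(s) = s^(- (d - 2) / 2) otherwise. *)
Definition kernD (R : realType) (d k : nat) (s : R) : R :=
  if d == 2%N then
    if k is k'.+1 then 2^-1 * ((-1) ^+ k' * k'`!%:R) * s ^- k else 2^-1 * ln s
  else (-1) ^+ k * pochhammer ((d%:R - 2) / 2) k * s `^ (- ((d%:R - 2) / 2) - k%:R).

(** This includes Z = 0, where both sides are 0. *)
Lemma kernD0 (R : realType) d (Z : 'rV[R]_d) : (2 <= d)%N -> kern Z = kernD d 0 (dot Z Z).
Proof.
move=> d1; rewrite /kern /kernD; case: eqP => [d2|/eqP d2].
  have [->|Z0] := eqVneq Z 0; last exact: ln_enorm.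
  by rewrite /enorm dot0l sqrtr0 !ln0 // mulr0.
rewrite /pochhammer big_ord0 expr0 !mul1r subr0 powRN.
rewrite /enorm -powR12_sqrt ?dot_ge0 // -powR_mulrn ?powR_ge0 // -powRrM.
by congr (_ `^ _)^-1; rewrite natrB // mulrC.
Qed.

Lemma kernD_derive (R : realType) d k (s : R) : 0 < s ->
  is_derive s 1 (@kernD R d k) (kernD d k.+1 s).
Proof.
move=> s0; rewrite /kernD; case: ifP => d2.
  have s1 : s != 0 by rewrite gt_eqF.
  case: k => [|k].
    have h := is_derive1_ln s0.
    apply: (is_derive_eq (is_deriveZ 2^-1 h)).
    by rewrite expr0 mul1r mulr1 expr1.
  have h : is_derive s 1 (fun y : R => y ^+ k.+1) (k.+1%:R * s ^+ k).
    have -> : (fun y : R => y ^+ k.+1) = id ^+ k.+1.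
      by apply/funext => y; rewrite exprfctE.
    apply: (is_derive_eq (is_deriveX k.+1 (is_derive_id s (1 : R)))).
    by rewrite -[_ *: _]/(_ * _) mulr1.
  have h2 := is_deriveV (f := fun y => y ^+ k.+1) (expf_neq0 k.+1 s1) h.
  apply: (is_derive_eq (is_deriveZ (2^-1 * ((-1) ^+ k * k`!%:R)) h2)).
  rewrite -[_ *: (_ *: _)]/(_ * (_ * _)) factS natrM !exprS.
  by field; rewrite s1 expf_neq0.
set a := (d%:R - 2) / 2.
have h := @is_derive1_powR R (- a - k%:R) s s0.
apply: (is_derive_eq (is_deriveZ ((-1) ^+ k * pochhammer a k) h)).
rewrite /pochhammer big_ord_recr /= exprS -natr1 opprD addrA.
rewrite -[_ *: _]/(_ * _); ring.
Qed.

Lemma sdiff_shift (R : realType) (l : seq R) (f : R -> R) m s :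
  sdiff l (fun y => f (y + s)) m = sdiff l f (m + s).
Proof.
elim: l m => //= a l IH m; rewrite /sdiff /= -!/(sdiff _ _ _) !IH.
by rewrite (addrAC m a) (addrAC m (- a)).
Qed.

Section OrbitSum.
Variables (R : realType) (d : nat) (S P : {fset 'rV[R]_d}) (H : 'rV[R]_d).
Hypothesis B : based_roots S P H.
Hypothesis fW : finite_set [set w | weyl S w].
Hypothesis d1 : (2 <= d)%N.
Implicit Types (x : 'rV[R]_d) (t : R).

(** By Weyl's identity, the alternating sum over the orbit of t rho is an iterated
    difference of phi with steps - 2 t <a, x>. *)
Lemma orbit_sum_mean x t :
  let s := dot x x + t ^+ 2 * dot (rootsum P) (rootsum P) in
  let e := \sum_(a <- P) `|2 * t * dot a x| in
  e < s ->
  exists2 y, `|y - s| <= e &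
    \sum_(w <- weylf S) \det w * kern (x - (t *: rootsum P) *m w) =
    \prod_(a <- P) (- 4 * t * dot a x) * kernD d #|` P| y.
Proof.
move=> s e es.
pose L (m : 'rV[R]_d) := - (2 * t) * dot m x.
have E : e = abs_sum (map L P).
  rewrite /abs_sum big_map; apply: eq_bigr => a _.
  by rewrite /L mulNr normrN.
have := @sdiff_mean R (@kernD R d) (fun k s => @kernD_derive R d k s) (map L P) 0%N s.
rewrite -E => /(_ es)[y ys ye]; exists y => //.
rewrite size_map add0n in ye.
rewrite (_ : \prod_(a <- P) _ = \prod_(h <- map L P) (2 * h)); last first.
  by rewrite big_map; apply: eq_bigr => a _; rewrite /L; ring.
rewrite -ye -[s]add0r -sdiff_shift.
have L0 : L 0 = 0 by rewrite /L dot0l mulr0.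
rewrite -[in RHS]L0 /sdiff -sfold_map; first last.
- by move=> u v; rewrite /L dotBl mulrBr.
- by move=> u v; rewrite /L dotDl mulrDr.
rewrite -/(sdiff _ _ _) (weyl_identity B fW) big_seq [RHS]big_seq.
apply: eq_bigr => w /(weylfP _ fW) ww; congr (_ * _).
rewrite kernD0 //= ; congr kernD.
rewrite -scalemxAl !(dotBl, dotBr, dotZl, dotZr) (weyl_dot _ _ ww) /L /s.
by rewrite (dotC x (_ *m _)); ring.
Qed.

(** The limit as t tends to 0 of the quotient by the products of the roots. *)
Lemma orbit_sum_value x (g : R -> R) : x != 0 ->
  (forall a, a \in P -> dot a x != 0) ->
  {for 0, continuous g} ->
  (\forall t \near 0,
    \sum_(w <- weylf S) \det w * kern (x - (t *: rootsum P) *m w) =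
    rootprod P x * rootprod P (t *: rootsum P) * g t) ->
  g 0 = (- 4) ^+ #|` P| * kernD d #|` P| (dot x x) / rootprod P (rootsum P).
Proof.
move=> x0 xP gc ge.
have rho0 : rootprod P (rootsum P) != 0.
  rewrite prodf_seq_neq0; apply/allP => a aP /=.
  by rewrite dotC gt_eqF // (dot_rootsum_pos B).
have px0 : rootprod P x != 0.
  by rewrite prodf_seq_neq0; apply/allP => a aP /=; exact: xP.
pose s t := dot x x + t ^+ 2 * dot (rootsum P) (rootsum P).
pose e t : R := \sum_(a <- P) `|2 * t * dot a x|.
have xx : 0 < dot x x by rewrite dot_gt0.
have sc : s t @[t --> (0 : R)] --> dot x x.
  rewrite [X in _ --> X](_ : _ = s 0); last by rewrite /s expr0n mul0r addr0.
  apply: cvgD; first exact: cvg_cst.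
  by apply: cvgM; [exact: exprn_continuous|exact: cvg_cst].
have ec : e t @[t --> (0 : R)] --> (0 : R).
  rewrite [X in _ --> X](_ : _ = e 0); last first.
    by rewrite /e big1 // => a _; rewrite mulr0 mul0r normr0.
  apply: cvg_big => [|a _]; first exact: add_continuous.
  apply: cvg_norm; apply: cvgM; last exact: cvg_cst.
  by apply: cvgM; [exact: cvg_cst|exact: cvg_id].
(* h t is the point supplied by the mean value formula, where it applies *)
pose h t := xget 0 [set y | `|y - s t| <= e t /\
  \sum_(w <- weylf S) \det w * kern (x - (t *: rootsum P) *m w) =
    \prod_(a <- P) (- 4 * t * dot a x) * kernD d #|` P| y].
have hP : \forall t \near (0 : R), `|h t - s t| <= e t /\
  \sum_(w <- weylf S) \det w * kern (x - (t *: rootsum P) *m w) =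
    \prod_(a <- P) (- 4 * t * dot a x) * kernD d #|` P| (h t).
  have : \forall t \near (0 : R), e t < s t.
    have h0 : s t - e t @[t --> (0 : R)] --> dot x x.
      by rewrite -[X in _ --> X]subr0; exact: cvgB.
    near=> t; rewrite -subr_gt0; near: t; exact: (cvgr_gt _ h0 _ xx).
  apply: filterS => t /orbit_sum_mean[y y1 y2].
  by rewrite /h; case: xgetP => [_ _ //|/(_ y)[]].
have hc : h t @[t --> (0 : R)] --> dot x x.
  apply: (squeeze_cvgr (f := fun t => s t - e t) (h := fun t => s t + e t)).
  - near=> t; have [] : `|h t - s t| <= e t /\
     \sum_(w <- weylf S) \det w * kern (x - (t *: rootsum P) *m w) =
     \prod_(a <- P) (- 4 * t * dot a x) * kernD d #|` P| (h t) by near: t.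
    by rewrite ler_distl.
  - by rewrite -[X in _ --> X]subr0; exact: cvgB.
  - by rewrite -[X in _ --> X]addr0; exact: cvgD.
have kc : kernD d #|` P| (h t) @[t --> (0:R)] --> kernD d #|` P| (dot x x).
  have c1 : {for dot x x, continuous (@kernD R d #|` P|)}.
    have := @kernD_derive R d #|` P| _ xx => /@ex_derive.
    by move=> /derivable1_diffP/differentiable_continuous.
  exact: (cvg_comp h (@kernD R d #|` P|) hc c1).
have gv : \forall t \near 0^',
    (- 4) ^+ #|` P| * kernD d #|` P| (h t) / rootprod P (rootsum P) = g t.
  have hP' := nbhs_dnbhs hP; have ge' := nbhs_dnbhs ge.
  near=> t.
  have t0 : t != 0 by near: t; exact: nbhs_dnbhs_neq.
  have [_ e1] : `|h t - s t| <= e t /\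
     \sum_(w <- weylf S) \det w * kern (x - (t *: rootsum P) *m w) =
     \prod_(a <- P) (- 4 * t * dot a x) * kernD d #|` P| (h t) by near: t.
  have e2 : \sum_(w <- weylf S) \det w * kern (x - (t *: rootsum P) *m w) =
    rootprod P x * rootprod P (t *: rootsum P) * g t by near: t.
  move: e2; rewrite e1 big_split /= big_const_seq count_predT iter_mulr_1.
  have -> : rootprod P (t *: rootsum P) = t ^+ #|` P| * rootprod P (rootsum P).
    rewrite /rootprod; under eq_bigr do rewrite dotZr.
    by rewrite big_split /= big_const_seq count_predT iter_mulr_1.
  rewrite -/(rootprod P x) exprMn => e3.
  apply: (mulfI px0); apply: (mulfI (expf_neq0 #|` P| t0)); apply: (mulfI rho0).
  move: e3 rho0 px0; set r := rootprod P (rootsum P); set p := rootprod P x.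
  set k := kernD _ _ _ => e3 r0 p0.
  transitivity (p * (t ^+ #|` P| * r) * g t); last by ring.
  by rewrite -e3; field.
have k1 : (- 4) ^+ #|` P| * kernD d #|` P| (h t) / rootprod P (rootsum P) @[t --> 0^'] -->
   (- 4) ^+ #|` P| * kernD d #|` P| (dot x x) / rootprod P (rootsum P).
  apply: cvgM; last exact: cvg_cst.
  apply: cvgM; first exact: cvg_cst.
  by apply: cvg_trans kc; apply: cvg_app; exact: nbhs_dnbhs.
have k2 : g t @[t --> 0^'] -->
    (- 4) ^+ #|` P| * kernD d #|` P| (dot x x) / rootprod P (rootsum P).
  by apply: cvg_trans k1; exact: near_eq_cvg.
by move/continuous_withinNx : gc => gc; exact: (cvg_unique _ gc k2).
Unshelve. all: by end_near. Qed.

End OrbitSum.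

(** * Positivity of the sphere area *)

Section GammaPositive.
Variable R : realType.

(** From ln u <= u - 1 at u = t / (2 p). *)
Lemma powR_le_expR (p t : R) : 0 < p -> 0 < t ->
  t `^ p <= expR (p * ln (2 * p)) * expR (t / 2).
Proof.
move=> p0 t0; rewrite /powR gt_eqF // -expRD ler_expR.
have q0 : 0 < t / (2 * p) by rewrite divr_gt0 // mulr_gt0.
have : ln (t / (2 * p)) <= t / (2 * p) - 1.
  by have := @le_ln1Dx R (t / (2 * p) - 1); rewrite addrCA subrr addr0; apply; lra.
rewrite ln_div ?posrE ?mulr_gt0 // => h.
have : p * (ln t - ln (2 * p)) <= p * (t / (2 * p) - 1) by rewrite ler_pM2l.
have -> : p * (t / (2 * p) - 1) = t / 2 - p by field; rewrite gt_eqF.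
by rewrite mulrBr; lra.
Qed.

Let f (x t : R) : R := t `^ (x - 1) * expR (- t).

Lemma Gamma_integrand_measurable x (D : set R) : measurable D ->
  measurable_fun D (EFin \o f x).
Proof.
move=> mD; apply/measurable_EFinP; apply: (@measurable_funS _ _ _ _ setT) => //.
apply: measurable_funM; first exact: measurable_powR.
by apply: measurableT_comp => //; exact: measurable_funN.
Qed.

Lemma Gamma_integrand_ge0 x t : 0 <= f x t.
Proof. by rewrite mulr_ge0 ?powR_ge0 ?expR_ge0. Qed.

Lemma Gamma_integrable x : 1 < x ->
  lebesgue_measure.-integrable `]0, +oo[ (EFin \o f x).
Proof.
move=> x1; have p0 : 0 < x - 1 by lra.
set C := 2 * expR ((x - 1) * ln (2 * (x - 1))).
have i1 : lebesgue_measure.-integrable (`]0, +oo[ : set R)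
    (fun t => C%:E * (EFin \o exponential_pdf (2^-1 : R)) t)%E.
  apply: integrableZl => //.
  apply: (@integrableS _ _ _ _ setT) => //.
  by apply: integrable_exponential_pdf; rewrite invr_gt0.
apply: le_integrable i1 => //; first exact: Gamma_integrand_measurable.
move=> t; rewrite /= in_itv /= andbT => t0; rewrite lee_fin.
rewrite ger0_norm ?Gamma_integrand_ge0 // exponential_pdfE ?(ltW t0) //.
rewrite ger0_norm; last by rewrite !mulr_ge0 ?expR_ge0 // invr_ge0.
have -> : C * (2^-1 * expR (- 2^-1 * t)) =
  expR ((x - 1) * ln (2 * (x - 1))) * expR (t / 2) * expR (- t).
  have -> : expR (- 2^-1 * t) = expR (t / 2) * expR (- t).
    by rewrite -expRD; congr expR; field.
  by rewrite /C; field.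
by rewrite /f ler_pM2r ?expR_gt0 //; exact: powR_le_expR.
Qed.

Lemma Gamma_gt0 (x : R) : 1 < x -> 0 < Gamma x.
Proof.
move=> x1; have i := Gamma_integrable x1.
rewrite /Gamma /Rintegral fine_gt0 //; apply/andP; split; last first.
  have /integrableP[_] := i; apply: le_lt_trans.
  rewrite le_eqVlt; apply/orP; left; apply/eqP; apply: eq_integral => t _ /=.
  by rewrite ger0_norm // Gamma_integrand_ge0.
have h : (\int[lebesgue_measure]_(t in `[1%R, 2%R]) (cst (expR (- 2))%:E t) <=
    \int[lebesgue_measure]_(t in `]0%R, +oo[) (f x t)%:E)%E.
  apply: (@le_trans _ _ (\int[lebesgue_measure]_(t in `[1%R, 2%R]) (f x t)%:E)%E).
    apply: ge0_le_integral => //.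
    - by move=> t _; rewrite lee_fin expR_ge0.
    - exact: Gamma_integrand_measurable.
    move=> t /=; rewrite in_itv /= => /andP[t1 t2]; rewrite lee_fin /f.
    have h1 : 1 <= t `^ (x - 1).
      have e1 : (1 : R) `^ (x - 1) = 1 by rewrite powR1.
      by rewrite -[leLHS]e1; apply: ge0_ler_powR; rewrite ?nnegrE //; lra.
    have h2 : expR (- 2) <= expR (- t) by rewrite ler_expR lerN2.
    by apply: (le_trans h2); rewrite ler_peMl ?expR_ge0.
  apply: ge0_subset_integral => //; first exact: Gamma_integrand_measurable.
    by move=> t _; rewrite lee_fin Gamma_integrand_ge0.
  by move=> t /=; rewrite !in_itv /= andbT => /andP[t1 _]; exact: lt_le_trans t1.
apply: lt_le_trans h; rewrite integral_cst //= lebesgue_measure_itv /= lte_fin ltr1n /=.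
by rewrite -EFinB -EFinM lte_fin mulr_gt0 ?expR_gt0 //; lra.
Qed.

Lemma sphere_area_neq0 d : (3 <= d)%N -> sphere_area R d != 0.
Proof.
move=> d3; have g : 0 < Gamma (d%:R / 2 : R).
  by apply: Gamma_gt0; rewrite ltr_pdivlMr // mul1r ltr_nat.
rewrite /sphere_area !mulf_neq0 ?invr_eq0 ?(gt_eqF g) ?pnatr_eq0 //.
by rewrite gt_eqF // powR_gt0 ?pi_gt0.
Qed.

End GammaPositive.

(** * Splitting the orbit sum along the stabiliser of Y0 *)

Lemma based_of_root_system (R : realType) (d : nat) (S P : {fset 'rV[R]_d}) :
  root_system S -> positive_system S P -> exists H, based_roots S P H.
Proof.
move=> [h1 h2 h3 h4 h5] [H [Hr ->]]; exists H; split=> //.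
by move=> a; rewrite !inE.
Qed.

Lemma sqdist_continuous (R : realType) (d : nat) (Y : 'rV[R]_d) :
  continuous (fun Z : 'rV[R]_d => dot (Z - Y) (Z - Y)).
Proof.
apply: continuous_big => [|i _ Z]; first exact: add_continuous.
have h : {for Z, continuous (fun Z : 'rV[R]_d => (Z - Y) 0 i)}.
  rewrite (_ : (fun _ => _) = fun Z : 'rV[R]_d => Z 0 i - Y 0 i); last first.
    by apply/funext => U; rewrite !mxE.
  by apply: continuousB; [exact: coord_continuous|exact: cst_continuous].
exact: (continuousM h h).
Qed.

Section Setup.
Variables (R : realType) (d : nat) (S P : {fset 'rV[R]_d}) (H Y0 : 'rV[R]_d).
Hypothesis B : based_roots S P H.
Hypothesis fW : finite_set [set w | weyl S w].
Hypothesis d1 : (2 <= d)%N.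
Hypothesis domY0 : dominant P Y0.

(** The roots orthogonal to Y0, and the positive ones among them. *)
Definition stab_roots := [fset a in S | dot a Y0 == 0].
Definition stab_pos := [fset a in P | dot a Y0 == 0].
Local Notation S' := stab_roots.
Local Notation P' := stab_pos.
Local Notation P'' := (P `\` P').
Local Notation V2 := (weylf S `\` weylf S').

Lemma stab_based : based_roots S' P' H.
Proof.
split.
- by move=> a; rewrite !inE /= => /andP[aS _]; exact: (br_neq0 B).
- by move=> a c; rewrite !inE /= => /andP[aS _] /andP[bS _]; exact: (br_reduced B aS bS).
- move=> a b; rewrite !inE /= => /andP[aS /eqP a0] /andP[bS /eqP b0].
  by rewrite (br_refl B) //= mul_refl dotBl dotZl a0 b0 mulr0 subr0 eqxx.
- by move=> a b; rewrite !inE /= => /andP[aS _] /andP[bS _]; exact: (br_int B).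
- by move=> a; rewrite !inE /= => /andP[aS _]; exact: (br_reg B).
by move=> a; rewrite !inE (br_pos B) -andbA [in RHS]andbAC -andbA.
Qed.

Lemma stab_sub w : weyl S' w -> weyl S w.
Proof. by apply: weyl_sub => a; rewrite !inE /= => /andP[]. Qed.

Lemma stab_finite : finite_set [set w | weyl S' w].
Proof. by apply: sub_finite_set fW => w /=; exact: stab_sub. Qed.

Lemma stab_fix w : weyl S' w -> Y0 *m w = Y0.
Proof.
elim=> [|a v]; first by rewrite mulmx1.
by rewrite !inE /= => /andP[_ /eqP aY] _ IH; rewrite mulmxA mul_refl_fix // dotC.
Qed.

Lemma pos_indep a b : a \in P -> b \in P -> a != b ->
  exists u, dot a u = 1 /\ dot b u = 0.
Proof.
move=> aP bP ab; have b0 := pos_neq0 B bP.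
have nb : 0 < dot b b by rewrite dot_gt0.
set u := a - (dot a b / dot b b) *: b.
have bu : dot b u = 0.
  by rewrite dotBr dotZr (dotC b a) divfK ?subrr // gt_eqF.
have au : dot a u != 0.
  apply/eqP => h; move: ab; apply/negP/negPn.
  have e : a = (dot a b / dot b b) *: b.
    apply: dot_CS_colinear => //.
    move: h; rewrite dotBr dotZr => /eqP; rewrite subr_eq0 => /eqP ->.
    by rewrite mulrAC divfK ?gt_eqF // -expr2.
  by move: aP; rewrite e => /(pos_colinear B bP) ->.
exists ((dot a u)^-1 *: u); rewrite !dotZr bu mulr0; split=> //.
by rewrite mulVf.
Qed.

Lemma stab_pos_sub a : a \in P' -> a \in P.
Proof. by rewrite !inE /= => /andP[]. Qed.

Lemma stab_pos_orth a : a \in P' -> dot a Y0 = 0.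
Proof. by rewrite !inE /= => /andP[_ /eqP]. Qed.

Lemma rootprod_neq0 (Q : {fset 'rV[R]_d}) X :
  (forall a, a \in Q -> dot a X != 0) -> rootprod Q X != 0.
Proof. by move=> h; rewrite prodf_seq_neq0; apply/allP => a aQ /=; exact: h. Qed.

Lemma rootprod_split X : rootprod P X = rootprod P' X * rootprod P'' X.
Proof.
rewrite /rootprod (bigID (mem P')) /= -[X in X * _]big_filter -[X in _ * X]big_filter.
congr (_ * _); apply: perm_big; apply: uniq_perm; rewrite ?filter_uniq ?fset_uniq //.
  move=> a; rewrite mem_filter /=; apply/andP/idP => [[]//|aP]; split=> //.
  exact: stab_pos_sub.
by move=> a; rewrite mem_filter in_fsetD.
Qed.

Lemma sum_weylf_split (F : 'M[R]_d -> R) :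
  \sum_(w <- weylf S) F w = \sum_(w <- weylf S') F w + \sum_(w <- V2) F w.
Proof.
rewrite (bigID (mem (weylf S'))) /= -[X in X + _]big_filter -[X in _ + X]big_filter.
congr (_ + _); apply: perm_big; apply: uniq_perm; rewrite ?filter_uniq ?fset_uniq //.
  move=> a; rewrite mem_filter; apply/andP/idP => [[]//|aP]; split=> //.
  by apply/(weylfP _ fW); apply: stab_sub; apply/(weylfP _ stab_finite).
by move=> a; rewrite mem_filter in_fsetD.
Qed.

(** X != Y0 is outside the orbit of Y0 under its stabiliser. *)
Lemma stab_div X1 : X1 != Y0 ->
  exists2 g, nearby_continuous (X1, Y0) g &
    \forall z \near (X1, Y0), \sum_(w <- weylf S') \det w * kern (z.1 - z.2 *m w) =
      rootprod P' z.1 * rootprod P' z.2 * g z.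
Proof.
move=> XY; have B' := stab_based; have fW' := stab_finite.
apply: kernel_sum_div.
- by move=> a /(pos_neq0 B').
- by move=> a b /stab_pos_sub aP /stab_pos_sub bP; exact: pos_indep.
- move=> a w /(pos_root B') aP /(weylfP _ fW') ww; apply/(weylfP _ fW').
  exact: weylM.
- move=> a w /(pos_root B') aP /(weylfP _ fW') ww; apply/(weylfP _ fW').
  by apply: weyl_mulr => //; exact: weyl_refl.
- by move=> w /(weylfP _ fW')/weyl_det_sqr.
by move=> w /(weylfP _ fW')/stab_fix /= ->.
Qed.

(** No element outside the stabiliser fixes Y0, so the other terms have no pole at
    (Y0, Y0). *)
Lemma rest_div : exists2 g, nearby_continuous (Y0, Y0) g &
    \forall z \near (Y0, Y0), \sum_(w <- V2) \det w * kern (z.1 - z.2 *m w) =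
      rootprod P' z.1 * rootprod P' z.2 * g z.
Proof.
have B' := stab_based; have fW' := stab_finite.
have inV2 w : w \in V2 <-> weyl S w /\ ~ weyl S' w.
  rewrite inE; split=> [/andP[/(weylfP _ fW') ? /(weylfP _ fW) ?]//|[w1 w2]].
  by apply/andP; split; [apply/(weylfP _ fW')|apply/(weylfP _ fW)].
apply: kernel_sum_div.
- by move=> a /(pos_neq0 B').
- by move=> a b /stab_pos_sub aP /stab_pos_sub bP; exact: pos_indep.
- move=> a w /(pos_root B') aP /inV2[w1 w2]; apply/inV2; split.
    by apply: weylM => //; move: aP; rewrite !inE /= => /andP[].
  move=> h; apply: w2; rewrite -[w]mul1mx -(refl_sqr a) -mulmxA.
  exact: weylM.
- move=> a w /(pos_root B') aP /inV2[w1 w2]; apply/inV2; split.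
    by apply: weyl_mulr => //; apply: weyl_refl; move: aP; rewrite !inE /= => /andP[].
  move=> h; apply: w2; rewrite -[w]mulmx1 -(refl_sqr a) mulmxA.
  by apply: weyl_mulr => //; exact: weyl_refl.
- by move=> w /inV2[/weyl_det_sqr].
move=> w /inV2[w1 w2] /=; apply/eqP => e; apply: w2.
exact: (weyl_stab B fW domY0 w1 (esym e)).
Qed.

(** The value at (X, Y0) of the quotient by pi'(X) pi'(Y) of the sum over the
    stabiliser, according to [stab_valueE] below. *)
Definition stab_value (X : 'rV[R]_d) : R :=
  (- 4) ^+ #|` P'| * kernD d #|` P'| (dot (X - Y0) (X - Y0)) / rootprod P' (rootsum P').

Lemma ray_cvg (X U : 'rV[R]_d) : X + t *: U @[t --> (0 : R)] --> X.
Proof.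
rewrite -[Z in _ --> Z]addr0 -[Z in _ --> X + Z](scale0r U).
by apply: cvgD; [exact: cvg_cst|apply: cvgZl; exact: cvg_id].
Qed.

Lemma line_cvg (X Y U V : 'rV[R]_d) :
  (X + t *: U, Y + t *: V) @[t --> (0 : R)] --> (X, Y).
Proof. exact: (cvg_pair (@ray_cvg X U) (@ray_cvg Y V)). Qed.

(** Restriction to the ray Y = Y0 + t rho', which is regular for t != 0. *)
Lemma stab_value_regular X (g : 'rV[R]_d * 'rV[R]_d -> R) : X != Y0 ->
  (forall a, a \in P' -> dot a X != 0) ->
  {for (X, Y0), continuous g} ->
  (\forall z \near (X, Y0), \sum_(w <- weylf S') \det w * kern (z.1 - z.2 *m w) =
      rootprod P' z.1 * rootprod P' z.2 * g z) ->
  g (X, Y0) = stab_value X.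
Proof.
move=> XY Xreg gc ge.
have rp' U : rootprod P' (U + Y0) = rootprod P' U.
  rewrite /rootprod big_seq [RHS]big_seq; apply: eq_bigr => a aP.
  by rewrite dotDr stab_pos_orth // addr0.
have := @orbit_sum_value R d S' P' H stab_based stab_finite d1 (X - Y0)
  (fun t => g (X, Y0 + t *: rootsum P')).
rewrite scale0r addr0; apply.
- by rewrite subr_eq0.
- by move=> a aP; rewrite dotBr stab_pos_orth // subr0 Xreg.
- have l := @line_cvg X Y0 0 (rootsum P').
  have h : g (X, Y0 + t *: rootsum P') @[t --> (0 : R)] --> g (X, Y0).
    apply: (cvg_comp (fun t : R => (X, Y0 + t *: rootsum P')) g _ gc).
    by apply: cvg_trans l; apply: near_eq_cvg; near=> t; rewrite scaler0 addr0.
  change (g (X, Y0 + t *: rootsum P') @[t --> (0 : R)] -->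
    g (X, Y0 + 0 *: rootsum P')).
  by rewrite scale0r addr0.
have ge' := @line_cvg X Y0 0 (rootsum P') _ ge.
near=> t.
pose z t := (X + t *: 0, Y0 + t *: rootsum P').
have : \sum_(w <- weylf S') \det w * kern ((z t).1 - (z t).2 *m w) =
    rootprod P' (z t).1 * rootprod P' (z t).2 * g (z t) by near: t; exact: ge'.
rewrite /z /= scaler0 addr0 addrC rp' -{2}(subrK Y0 X) rp' => <-.
rewrite big_seq [RHS]big_seq; apply: eq_bigr => w /(weylfP _ stab_finite) ww.
congr (_ * kern _); rewrite mulmxDl (stab_fix ww) opprD addrA addrAC.
by rewrite -scalemxAl.
Unshelve. all: by end_near. Qed.

Lemma stab_value_cont X : X != Y0 -> {for X, continuous stab_value}.
Proof.
move=> XY.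
have x0 : 0 < dot (X - Y0) (X - Y0) by rewrite dot_gt0 subr_eq0.
have c0 := @sqdist_continuous R d Y0 X.
have c1 : {for dot (X - Y0) (X - Y0), continuous (@kernD R d #|` P'|)}.
  have := @kernD_derive R d #|` P'| _ x0 => /@ex_derive.
  by move=> /derivable1_diffP/differentiable_continuous.
have h := cvg_comp (fun Z : 'rV[R]_d => dot (Z - Y0) (Z - Y0)) (@kernD R d #|` P'|) c0 c1.
exact: (cvgM (cvgM (cvg_cst _) h) (cvg_cst _)).
Qed.

(** Singular points X are approached along the regular points X + t H. *)
Lemma stab_valueE X (g : 'rV[R]_d * 'rV[R]_d -> R) : X != Y0 ->
  nearby_continuous (X, Y0) g ->
  (\forall z \near (X, Y0), \sum_(w <- weylf S') \det w * kern (z.1 - z.2 *m w) =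
      rootprod P' z.1 * rootprod P' z.2 * g z) ->
  g (X, Y0) = stab_value X.
Proof.
move=> XY gc ge.
have l := @line_cvg X Y0 H 0.
pose h t := g (X + t *: H, Y0 + t *: 0) - stab_value (X + t *: H).
suff : h 0 = 0 by rewrite /h !scale0r !addr0 => /eqP; rewrite subr_eq0 => /eqP.
apply: cont_eq_dnbhs.
  apply: cvgB.
    rewrite !scale0r !addr0; apply: (cvg_comp _ g l); exact: (nbhs_singleton gc).
  rewrite !scale0r !addr0.
  apply: (cvg_comp (fun t => X + t *: H) stab_value); last exact: stab_value_cont.
  exact: ray_cvg.
have gc' := nbhs_dnbhs (l _ (near_join gc)).
have ge' := nbhs_dnbhs (l _ (near_join ge)).
have gc1 := nbhs_dnbhs (l _ gc).
have reg : \forall t \near (0:R)^', forall a, a \in P' -> dot a (X + t *: H) != 0.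
  apply: (@near_forall_seq _ _ ((0:R)^') _ P'
    (fun a t => dot a (X + t *: H) != 0)) => a aP.
  near=> t; rewrite dotDr dotZr; near: t; apply: affine_neq0_near.
  by rewrite gt_eqF // (pos_height B) // stab_pos_sub.
have ne : \forall t \near (0:R)^', X + t *: H != Y0.
  have hX : X + t *: H - Y0 @[t --> (0 : R)] --> X - Y0.
    by apply: cvgB; [exact: ray_cvg|exact: cvg_cst].
  apply: nbhs_dnbhs; near=> t; rewrite -subr_eq0; near: t.
  by apply: (cvgr_neq0 _ hX); rewrite subr_eq0.
near=> t; apply/eqP; rewrite subr_eq0; apply/eqP.
rewrite scaler0 addr0; apply: stab_value_regular.
- by near: t.
- by near: t.
- have : {for (X + t *: H, Y0 + t *: 0), continuous g} by near: t; exact: gc1.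
  by rewrite scaler0 addr0.
have : \forall z \near (X + t *: H, Y0 + t *: 0),
  \sum_(w <- weylf S') \det w * kern (z.1 - z.2 *m w) =
      rootprod P' z.1 * rootprod P' z.2 * g z by near: t; exact: ge'.
by rewrite scaler0 addr0.
Unshelve. all: by end_near. Qed.

End Setup.

(** * Values of the Newton kernel *)

(** The constant factor in the denominator of the Newton kernel. *)
Definition newton_const (R : realType) (d : nat) (S : {fset 'rV[R]_d}) : R :=
  if d == 2%N then 2 * pi * #|` weylf S|%:R
  else #|` weylf S|%:R * (2 - d%:R) * sphere_area R d.

Lemma newton_formulaE (R : realType) (d : nat) (S P : {fset 'rV[R]_d}) X Y :
  newton_formula S P X Y =
  (newton_const S * rootprod P X * rootprod P Y)^-1 *
  \sum_(w <- weylf S) \det w * kern (X - Y *m w).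
Proof.
by rewrite /newton_formula /newton_const /kern; case: ifP.
Qed.

Section NewtonAt.
Variables (R : realType) (d : nat) (S P : {fset 'rV[R]_d}) (H Y0 : 'rV[R]_d).
Hypothesis B : based_roots S P H.
Hypothesis fW : finite_set [set w | weyl S w].
Hypothesis d1 : (2 <= d)%N.
Local Notation S' := (stab_roots S Y0).
Local Notation P' := (stab_pos P Y0).
Local Notation P'' := (P `\` P').
Local Notation V2 := (weylf S `\` weylf S').

Lemma rest_pos_neq0 : rootprod P'' Y0 != 0.
Proof.
apply: rootprod_neq0 => a; rewrite in_fsetD => /andP[h aP].
by apply: contraNneq h => e; rewrite !inE /= aP e eqxx.
Qed.

Lemma newton_const_neq0 : newton_const S != 0.
Proof.
have c0 : #|` weylf S|%:R != 0 :> R.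
  rewrite pnatr_eq0 cardfs_eq0; apply/fset0Pn; exists 1%:M.
  by apply/(weylfP _ fW); exact: weyl1.
rewrite /newton_const; case: ifP => [_|/eqP d2].
  have p0 : pi != 0 :> R by rewrite gt_eqF // pi_gt0.
  by rewrite !mulf_neq0 // pnatr_eq0.
have d3 : (3 <= d)%N by lia.
have d0 : 2 - d%:R != 0 :> R.
  by rewrite subr_eq0 eqr_nat; apply/eqP => e; apply: d2.
by apply: mulf_neq0; [exact: mulf_neq0|exact: sphere_area_neq0].
Qed.

Lemma rootprod_continuous (Q : {fset 'rV[R]_d}) : continuous (rootprod Q).
Proof.
apply: continuous_big => [|a _]; first exact: mul_continuous.
exact: dot_continuous.
Qed.

(** The Newton kernel as the sum of the contributions of the stabiliser of Y0 and
    of the rest of the Weyl group.  The limit that defines it is not vacuous: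
    (X + t H, Y0 + t H) is a regular pair for small t != 0. *)
Lemma newton_at X (g : 'rV[R]_d * 'rV[R]_d -> R) : X != Y0 ->
  rootprod P'' X != 0 -> {for (X, Y0), continuous g} ->
  (\forall z \near (X, Y0), \sum_(w <- V2) \det w * kern (z.1 - z.2 *m w) =
      rootprod P' z.1 * rootprod P' z.2 * g z) ->
  newton S P X Y0 = (newton_const S * rootprod P'' X * rootprod P'' Y0)^-1 *
    (stab_value P Y0 X + g (X, Y0)).
Proof.
move=> XY X0 gc ge.
have [g1 g1c g1e] := stab_div B fW XY.
rewrite -(stab_valueE B fW d1 XY g1c g1e).
pose p (z : 'rV[R]_d * 'rV[R]_d) := newton_const S * rootprod P'' z.1 * rootprod P'' z.2.
pose F z := (p z)^-1 * (g1 z + g z).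
have E : \forall z \near (X, Y0), regular_pairs P z -> newton_formula S P z.1 z.2 = F z.
  near=> z => -[r1 r2].
  have e1 : \sum_(w <- weylf S') \det w * kern (z.1 - z.2 *m w) =
      rootprod P' z.1 * rootprod P' z.2 * g1 z by near: z.
  have e2 : \sum_(w <- V2) \det w * kern (z.1 - z.2 *m w) =
      rootprod P' z.1 * rootprod P' z.2 * g z by near: z.
  rewrite newton_formulaE (sum_weylf_split Y0 fW) e1 e2 /F /p.
  move: r1 r2; rewrite !(rootprod_split P Y0) !mulf_eq0 !negb_or.
  move=> /andP[a1 a2] /andP[b1 b2].
  have key (k u u' v v' : R) : u != 0 -> v != 0 ->
      (k * (u * u') * (v * v'))^-1 * (u * v) = (k * u' * v')^-1.
    move=> u0 v0; rewrite !invfM.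
    rewrite (_ : _ * _ = k^-1 * u'^-1 * v'^-1 * (u^-1 * u) * (v^-1 * v)); last by ring.
    by rewrite !mulVf // !mulr1.
  by rewrite -mulrDr [LHS]mulrA key.
rewrite /newton; case: ifP => [/andP[r1 r2]|_].
  by rewrite (nbhs_singleton E).
have Fc : F z @[z --> (X, Y0)] --> F (X, Y0).
  have p0 : p (X, Y0) != 0.
    rewrite /p !mulf_neq0 ?rest_pos_neq0 ?newton_const_neq0 //.
  have pc : p z @[z --> (X, Y0)] --> p (X, Y0).
    apply: cvgM.
      apply: cvgM; first exact: cvg_cst.
      by apply: (cvg_comp fst (rootprod P''));
        [exact: cvg_fst|exact: rootprod_continuous].
    by apply: (cvg_comp snd (rootprod P''));
      [exact: cvg_snd|exact: rootprod_continuous].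
  apply: cvgM; first exact: cvgV.
  by apply: cvgD => //; exact: (nbhs_singleton g1c).
have pf : ProperFilter (within (regular_pairs P) (nbhs (X, Y0))).
  apply: within_nbhs_proper => U nU.
  have nU' := nbhs_dnbhs (@line_cvg R d X Y0 H H _ nU).
  have reg Z : \forall t \near (0:R)^', rootprod P (Z + t *: H) != 0.
    have h : \forall t \near (0:R)^', forall a, a \in P -> dot a (Z + t *: H) != 0.
      apply: (@near_forall_seq _ _ ((0:R)^') _ P
        (fun a t => dot a (Z + t *: H) != 0)) => a aP.
      near=> t; rewrite dotDr dotZr; near: t; apply: affine_neq0_near.
      by rewrite gt_eqF // (pos_height B).
    by near=> t; apply: rootprod_neq0; near: t.
  near ((0:R)^') => t.
  exists (X + t *: H, Y0 + t *: H); split; last by near: t; exact: nU'.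
  by split=> /=; near: t; exact: reg.
apply: cvg_lim => //.
have Fc' : F z @[z --> within (regular_pairs P) (nbhs (X, Y0))] --> F (X, Y0).
  by apply: cvg_trans Fc; apply: cvg_app; exact: cvg_within.
apply: cvg_trans Fc'; apply: near_eq_cvg.
by near=> z; apply/esym; near: z; exact: E.
Unshelve. all: by end_near. Qed.

End NewtonAt.

(** * Asymptotics of the Newton kernel *)

Section Asymptotics.
Variables (R : realType) (d : nat) (S P : {fset 'rV[R]_d}) (H Y0 : 'rV[R]_d).
Hypothesis B : based_roots S P H.
Hypothesis fW : finite_set [set w | weyl S w].
Hypothesis d1 : (2 <= d)%N.
Hypothesis domY0 : dominant P Y0.
Local Notation S' := (stab_roots S Y0).
Local Notation P' := (stab_pos P Y0).
Local Notation P'' := (P `\` P').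
Local Notation V2 := (weylf S `\` weylf S').

Lemma enorm_continuous : {for Y0, continuous (fun X : 'rV[R]_d => enorm (X - Y0))}.
Proof.
apply: (cvg_comp (fun X : 'rV[R]_d => dot (X - Y0) (X - Y0)) Num.sqrt).
  exact: sqdist_continuous.
exact: sqrt_continuous.
Qed.

(** The contribution of the stabiliser dominates, being of negative degree in
    |X - Y0| while the other one is bounded. *)
Lemma newton_asymp (C : R) (N : nat) : C != 0 -> (0 < N)%N ->
  (forall X, X != Y0 -> stab_value P Y0 X = C * enorm (X - Y0) ^- N) ->
  asymp_at (fun X => newton S P X Y0)
    (fun X => C / (newton_const S * rootprod P'' Y0 ^+ 2) * enorm (X - Y0) ^- N) Y0.
Proof.
move=> C0 N0 sv.
have [g gc ge] := rest_div B fW domY0.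
have n0 := newton_const_neq0 fW d1.
have r0 := rest_pos_neq0 P Y0.
have diag : ((X : 'rV[R]_d), Y0) @[X --> Y0] --> (Y0, Y0).
  apply: (@cvg_pair _ _ _ (nbhs Y0) (nbhs Y0) (nbhs Y0)); first exact: cvg_id.
  exact: cvg_cst.
have gc' := nbhs_dnbhs (diag _ gc).
have ge' := nbhs_dnbhs (diag _ (near_join ge)).
have rn : \forall X \near Y0^', rootprod P'' X != 0.
  by apply: nbhs_dnbhs; exact: (cvgr_neq0 _ (@rootprod_continuous R d P'' Y0) r0).
(* F is the quotient in question, with the powers of the norm cancelled *)
pose F (X : 'rV[R]_d) := rootprod P'' Y0 / rootprod P'' X *
  (1 + g (X, Y0) * enorm (X - Y0) ^+ N / C).
have Fc : {for Y0, continuous F}.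
  have cc (k : R) : {for Y0, continuous (fun=> k)} by exact: cst_continuous.
  have h1 : {for Y0, continuous (fun X : 'rV[R]_d => (rootprod P'' X)^-1)}.
    by apply: continuousV => //; exact: (@rootprod_continuous R d P'' Y0).
  have h2 : {for Y0, continuous (fun X : 'rV[R]_d => g (X, Y0))}.
    exact: (cvg_comp (fun X : 'rV[R]_d => (X, Y0)) g diag (nbhs_singleton gc)).
  have h3 : {for Y0, continuous (fun X : 'rV[R]_d => enorm (X - Y0) ^+ N)}.
    apply: (cvg_comp (fun X : 'rV[R]_d => enorm (X - Y0)) (fun t : R => t ^+ N)).
      exact: enorm_continuous.
    exact: exprn_continuous.
  exact: (continuousM (continuousM (cc _) h1)
    (continuousD (cc _) (continuousM (continuousM h2 h3) (cc _)))).
have F1 : F Y0 = 1.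
  rewrite /F subrr /enorm dot0l sqrtr0 expr0n (gtn_eqF N0) mulr0 mul0r addr0.
  by rewrite divff ?mulr1.
rewrite /asymp_at -F1.
have Fc' : F X @[X --> Y0^'] --> F Y0.
  by apply: cvg_trans Fc; apply: cvg_app; exact: nbhs_dnbhs.
apply: cvg_trans Fc'; apply: near_eq_cvg; near=> X.
have XY : X != Y0 by near: X; exact: nbhs_dnbhs_neq.
have rX : rootprod P'' X != 0 by near: X.
have E0 : enorm (X - Y0) != 0 by rewrite gt_eqF // sqrtr_gt0 dot_gt0 subr_eq0.
rewrite (newton_at B fW d1 XY rX (g := g)).
- rewrite sv // /F.
  have EN : enorm (X - Y0) ^+ N != 0 by rewrite expf_neq0.
  by field; rewrite n0 r0 rX C0 EN.
- by near: X; exact: gc'.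
by near: X; exact: ge'.
Unshelve. all: by end_near. Qed.

End Asymptotics.

Lemma stab_value_rank2 (R : realType) (P : {fset 'rV[R]_2}) (Y0 X : 'rV[R]_2) :
  (0 < #|` stab_pos P Y0|)%N ->
  let n := #|` stab_pos P Y0| in
  stab_value P Y0 X = - (2 ^+ (2 * n - 1) * (n - 1)`!%:R) /
    rootprod (stab_pos P Y0) (rootsum (stab_pos P Y0)) * enorm (X - Y0) ^- (2 * n).
Proof.
rewrite /stab_value /=; case: #|` _| => // n _.
rewrite /kernD /= (_ : n.+1 - 1 = n)%N; last by lia.
have -> : dot (X - Y0) (X - Y0) ^- n.+1 = enorm (X - Y0) ^- (2 * n.+1).
  by rewrite -enorm_sqr -exprM.
have -> : (2 : R) ^+ (2 * n.+1 - 1) = 2 * (2 ^+ 2) ^+ n.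
  by rewrite -exprM -exprS; congr (_ ^+ _); lia.
have -> : (- 4 : R) ^+ n.+1 = - 4 * ((- 1) ^+ n * (2 ^+ 2) ^+ n).
  rewrite exprS -exprMn; congr (_ * _ ^+ _); ring.
have e : ((-1) ^+ n * (-1) ^+ n : R) = 1 by rewrite -exprMn mulrNN mulr1 expr1n.
move: e; set b : R := enorm _ ^- _; set u := (-1) ^+ n; set v := (2 ^+ 2) ^+ n => e.
rewrite (_ : - 4 * (u * v) * (2^-1 * (u * n`!%:R) * b) =
  (u * u) * (- (2 * v * n`!%:R)) * b).
  by rewrite e mul1r mulrAC.
by field.
Qed.

Lemma stab_value_rank_ge3 (R : realType) d (P : {fset 'rV[R]_d}) (Y0 X : 'rV[R]_d) :
  (3 <= d)%N -> X != Y0 ->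
  let n := #|` stab_pos P Y0| in
  stab_value P Y0 X = 2 ^+ (2 * n) * pochhammer ((d%:R - 2) / 2) n /
    rootprod (stab_pos P Y0) (rootsum (stab_pos P Y0)) *
    enorm (X - Y0) ^- (2 * n + d - 2).
Proof.
move=> d3 XY n; rewrite /stab_value -/n /kernD ifF; last by apply/eqP; lia.
have -> : dot (X - Y0) (X - Y0) `^ (- ((d%:R - 2) / 2) - n%:R) =
    enorm (X - Y0) ^- (2 * n + d - 2).
  rewrite -enorm_sqr -powR_mulrn ?sqrtr_ge0 // -powRrM -powR_invn ?sqrtr_ge0 //.
  congr (_ `^ _); rewrite natrB; last by lia.
  by rewrite natrD natrM; field.
have -> : (- 4 : R) ^+ n = (-1) ^+ n * 2 ^+ (2 * n).
  rewrite exprM -exprMn; congr (_ ^+ _); ring.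
have e : ((-1) ^+ n * (-1) ^+ n : R) = 1 by rewrite -exprMn mulrNN mulr1 expr1n.
set b : R := enorm _ ^- _; set u := (-1) ^+ n; set v := 2 ^+ (2 * n).
rewrite (_ : u * v * _ = (u * u) * (v * pochhammer ((d%:R - 2) / 2) n) * b);
  last by ring.
by rewrite e mul1r mulrAC.
Qed.

Lemma pochhammer_gt0 (R : realType) (a : R) n : 0 < a -> 0 < pochhammer a n.
Proof. by move=> a0; apply: prodr_gt0 => i _; rewrite ltr_wpDr. Qed.

(** In the plane, two vectors orthogonal to a nonzero one are colinear. *)
Lemma orth_colinear2 (R : realType) (a b Y : 'rV[R]_2) : Y != 0 -> b != 0 ->
  dot a Y = 0 -> dot b Y = 0 -> a = (dot a b / dot b b) *: b.
Proof.
move=> Y0 b0 aY bY; apply: dot_CS_colinear => //; move: aY bY.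
have dE (U V : 'rV[R]_2) : dot U V = U 0 0 * V 0 0 + U 0 1 * V 0 1.
  rewrite /dot !big_ord_recl big_ord0 addr0.
  by rewrite (_ : lift ord0 ord0 = 1 :> 'I_2) //; apply/val_inj.
rewrite !dE => aY bY.
set a0 := a 0 0 in aY *; set a1 := a 0 1 in aY *.
set b0' := b 0 0 in bY *; set b1 := b 0 1 in bY *.
have h0 : (a0 * b1 - a1 * b0') * Y 0 0 = 0.
  have -> : (a0 * b1 - a1 * b0') * Y 0 0 =
    b1 * (a0 * Y 0 0 + a1 * Y 0 1) - a1 * (b0' * Y 0 0 + b1 * Y 0 1) by ring.
  by rewrite aY bY; ring.
have h1 : (a0 * b1 - a1 * b0') * Y 0 1 = 0.
  have -> : (a0 * b1 - a1 * b0') * Y 0 1 =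
    a0 * (b0' * Y 0 0 + b1 * Y 0 1) - b0' * (a0 * Y 0 0 + a1 * Y 0 1) by ring.
  by rewrite aY bY; ring.
have h : a0 * b1 - a1 * b0' = 0.
  apply/eqP; apply: contraNT Y0 => h.
  rewrite -dot_eq0 dE.
  have /eqP := h0; rewrite mulf_eq0 (negPf h) /= => /eqP ->.
  have /eqP := h1; rewrite mulf_eq0 (negPf h) /= => /eqP ->.
  by rewrite mul0r addr0.
have : (a0 * b1 - a1 * b0') ^+ 2 = 0 by rewrite h expr0n.
have -> : (a0 * b1 - a1 * b0') ^+ 2 =
  (a0 * a0 + a1 * a1) * (b0' * b0' + b1 * b1) - (a0 * b0' + a1 * b1) ^+ 2 by ring.
by lra.
Qed.

Lemma closure_dominant (R : realType) d (P : {fset 'rV[R]_d}) Y :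
  closure (chamber P) Y -> dominant P Y.
Proof.
move=> cY a aP; rewrite leNgt; apply/negP => h.
have [|X [cX XU]] := cY [set X | dot a X < 0].
  have := @dot_continuous R d a Y.
  move=> c; have := cvgr_lt _ c _ h; exact.
by move: XU; rewrite /= ltNge ltW // cX.
Qed.

Theorem theorem3p13 (R : realType) (d : nat) (S P : {fset 'rV[R]_d})
    (Y0 : 'rV[R]_d)
    (HS : root_system S) (HP : positive_system S P)
    (HY0 : closure (chamber P) Y0) :
  let P' := [fset a in P | dot a Y0 == 0] in
  let P'' := P `\` P' in
  let gam := #|` P| in
  let gam' := #|` P'| in
  let cardW := #|` weylf S|%:R : R in
  (d = 2%N ->
     (Y0 = 0 -> forall X : 'rV[R]_d, X != 0 ->
        newton S P X Y0 =
          - (2 ^+ (2 * gam - 1) * (gam - 1)`!%:R)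
            / (2 * pi * cardW * rootprod P (rootsum P))
          * enorm X ^- (2 * gam)) /\
     (forall a b : 'rV[R]_d, a != b -> simple_root P a -> simple_root P b ->
        Y0 != 0 -> dot a Y0 != 0 -> dot b Y0 = 0 ->
        asymp_at (fun X => newton S P X Y0)
          (fun X => - (2 ^+ (2 * gam' - 1) * (gam' - 1)`!%:R)
             / (2 * pi * cardW * rootprod P'' Y0 ^+ 2 * dot b b)
             * enorm (X - Y0) ^- 2)
          Y0)) /\
  ((3 <= d)%N ->
     asymp_at (fun X => newton S P X Y0)
       (fun X => 2 ^+ (2 * gam') * pochhammer ((d%:R - 2) / 2) gam'
          / (cardW * (2 - d%:R) * sphere_area R d
             * rootprod P' (rootsum P') * rootprod P'' Y0 ^+ 2)
          * (1 / enorm (X - Y0) ^+ (2 * gam' + d - 2)))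
       Y0).
Proof.
move=> P' P'' gam gam' cardW.
have [H B] := based_of_root_system HS HP.
have fW : finite_set [set w | weyl S w].
  by apply: weyl_finite; [exact: root_refl HS|exact: root_span HS].
have domY0 := closure_dominant HY0.
have pr0 : rootprod P' (rootsum P') != 0.
  apply: rootprod_neq0 => a aP; rewrite dotC gt_eqF //.
  exact: (dot_rootsum_pos (stab_based Y0 B)).
split=> [d2|d3]; last first.
  have d1 : (2 <= d)%N by lia.
  have p0 : 0 < pochhammer ((d%:R - 2) / 2 : R) gam'.
    apply: pochhammer_gt0; rewrite divr_gt0 // subr_gt0 ltr_nat; lia.
  have C0 : 2 ^+ (2 * gam') * pochhammer ((d%:R - 2) / 2) gam' /
      rootprod P' (rootsum P') != 0.
    by rewrite !mulf_neq0 ?invr_eq0 ?expf_neq0 ?pnatr_eq0 // gt_eqF.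
  have := newton_asymp B fW d1 domY0 C0 (N := (2 * gam' + d - 2)%N).
  (* the constant is written in the form that newton_asymp produces *)
  rewrite /asymp_at (_ : (fun X => newton S P X Y0 / _) = (fun X => newton S P X Y0 /
       (2 ^+ (2 * gam') * pochhammer ((d%:R - 2) / 2) gam'
          / (cardW * (2 - d%:R) * sphere_area R d
             * rootprod P' (rootsum P') * rootprod P'' Y0 ^+ 2)
          * (1 / enorm (X - Y0) ^+ (2 * gam' + d - 2))))); last first.
    apply/funext => X; congr (_ / _); rewrite div1r; congr (_ * _).
    rewrite /newton_const ifF; last by apply/eqP; lia.
    by rewrite -mulrA -invfM; congr (_ / _); rewrite mulrCA mulrA.
  apply; first by lia.
  by move=> X XY; exact: stab_value_rank_ge3.
subst d.
have d1 : (2 <= 2)%N by [].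
split=> [Y00 X X0|a b ab sa sb Y00 aY bY].
  subst Y0.
  (* every root is orthogonal to 0, so the stabiliser is the whole group *)
  have P'E : P' = P by apply/fsetP => a; rewrite !inE /= dot0r eqxx andbT.
  have S'E : stab_roots S 0 = S by apply/fsetP => a; rewrite !inE /= dot0r eqxx andbT.
  have gam0 : (0 < gam)%N.
    have [a aS] : exists a, a \in S.
      apply/fset0Pn; apply: contraNneq X0 => S0.
      have : X \in <<enum_fset S>>%VS by rewrite (root_span HS) memvf.
      by rewrite S0 span_nil memv0.
    rewrite cardfs_gt0; apply/fset0Pn.
    by have [aP|/(root_pos_or B aS)] := boolP (a \in P); [exists a|exists (- a)].
  have P0E : stab_pos P 0 = P := P'E.
  rewrite (newton_at B fW d1 X0 (g := fun=> 0)).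
  - rewrite addr0 stab_value_rank2 P0E // fsetDv subr0 /rootprod !big_seq_fset0 !mulr1.
    rewrite /newton_const eqxx -/cardW -[\prod_(a <- P) _]/(rootprod P (rootsum P)).
    by rewrite [in RHS]invfM; ring.
  - by rewrite P0E fsetDv /rootprod big_seq_fset0 oner_neq0.
  - exact: cst_continuous.
  by near=> z; rewrite S'E fsetDv big_seq_fset0 mulr0.
have [bP _] := sb.
(* in the plane, b is the only positive root orthogonal to Y0 *)
have P'E : P' = [fset b].
  apply/fsetP => c; rewrite inE; apply/idP/eqP => [|->]; last first.
    by rewrite !inE /= bP bY eqxx.
  rewrite !inE /= => /andP[cP /eqP cY].
  have e := orth_colinear2 Y00 (pos_neq0 B bP) cY bY.
  by rewrite e; apply: (pos_colinear B bP); rewrite -e.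
have g1 : gam' = 1%N by rewrite /gam' P'E cardfs1.
have rb : rootprod P' (rootsum P') = dot b b.
  by rewrite P'E /rootprod /rootsum !big_seq_fset1.
have bb : dot b b != 0 by rewrite -rb.
have C0 : - (2 ^+ (2 * gam' - 1) * (gam' - 1)`!%:R) / rootprod P' (rootsum P') != 0.
  by rewrite g1 mulf_neq0 ?invr_eq0 // oppr_eq0 mulr1 expr1 pnatr_eq0.
have := newton_asymp B fW d1 domY0 C0 (N := 2%N).
rewrite /asymp_at rb (_ : (fun X => newton S P X Y0 / _) = (fun X => newton S P X Y0 /
      (- (2 ^+ (2 * gam' - 1) * (gam' - 1)`!%:R)
             / (2 * pi * cardW * rootprod P'' Y0 ^+ 2 * dot b b)
             * enorm (X - Y0) ^- 2))); last first.
  apply/funext => X; congr (_ / (_ * _)).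
  rewrite /newton_const eqxx -[LHS]mulrA -invfM; congr (_ / _).
  by rewrite mulrC.
apply=> // X XY.
by rewrite stab_value_rank2 -/gam' ?g1 // -/P' rb.
Unshelve. all: by end_near. Qed.
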